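(* Let $\mathcal H$ be a real Hilbert space and $T>0$. Let $C\colon[0,T]\rightrightarrows\mathcal H$ be a set-valued map with nonempty closed values for which there is $L_C\ge 0$ with $\operatorname{Haus}(C(t),C(s))\le L_C|t-s|$ for all $t,s\in[0,T]$, and let $x_0\in C(0)$. Let $F\colon[0,T]\times\mathcal H\rightrightarrows\mathcal H$ be a set-valued map with nonempty, closed and convex values such that: (1) for all $t\in[0,T]$, $F(t,\cdot)$ is upper semicontinuous from $\mathcal H$ into $\mathcal H_w$; (2) there is a Lipschitz continuous function $h\colon\mathcal H\to[0,+\infty[$ (with constant $L_h>0$) such that $d(0,F(t,x)):=\inf\{\|w\|:w\in F(t,x)\}\le h(x)$ for all $x\in\mathcal H$ and a.e. $t\in[0,T]$; (3) there are $\gamma>0$ and $f\colon[0,T]\times\mathcal H\to\mathcal H$ such that $f(t,x)\in\operatorname{proj}^{\gamma}_{F(t,x)}(0)$ for all $(t,x)$ and $f(\cdot,x)$ is measurable for all $x\in\mathcal H$. Suppose, in addition, that the family $(C(t))_{t\in[0,T]}$ is equi-uniformly subsmooth and that the sets $C(t)$ are ball-compact for all $t\in[0,T]$. Let $(\varepsilon_n)$, $(\eta_n)$ be sequences of positive numbers with $\varepsilon_n/\mu_n^2\to0$ and $\eta_n/\mu_n\to 0$, where $\mu_n:=T/n$, and let $(x_n)$ be any sequence of continuous functions generated by the inexact catching-up algorithm (with data $C,f,x_0,\varepsilon_n,\eta_n$) described in the context. Then $(x_n)$ converges uniformly on $[0,T]$, up to a subsequence, to a Lipschitz continuous solution $x(\cdot)$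 of $$\dot x(t)\in -N(C(t);x(t))+F(t,x(t))\ \text{ a.e. } t\in[0,T],\qquad x(0)=x_0\in C(0).$$
   Context: $\mathbb B$ is the closed unit ball of $\mathcal H$, and $\mathcal H_w$ is $\mathcal H$ with the weak topology. $d_S(x)=\inf_{z\in S}\|x-z\|$. $\operatorname{Haus}(A,B):=\max\{\sup_{x\in A}d_B(x),\sup_{x\in B}d_A(x)\}$. A set $S$ is ball-compact if $S\cap r\mathbb B$ is compact for all $r>0$. Upper semicontinuity of a set-valued map $G\colon\mathcal H\rightrightarrows\mathcal H$ from $\mathcal H$ into $\mathcal H_w$: for every weakly closed $D\subset\mathcal H$, the set $\{x: G(x)\cap D\ne\emptyset\}$ is closed in $\mathcal H$. For $x\in S$, the Clarke tangent cone $T(S;x)$ is the set of $h\in\mathcal H$ such that for every sequence $(x_n)$ in $S$ converging to $x$ and every sequence of positive numbers $(t_n)$ converging to $0$ there is a sequence $(h_n)$ converging to $h$ with $x_n+t_nh_n\in S$ for all $n$. The Clarke normal cone is $N(S;x):=\{v:\langle v,h\rangle\le0\ \forall h\in T(S;x)\}$ for $x\in S$, and $N(S;x)=\emptyset$ if $x\notin S$. A family $(S(t))_{t\in I}$ of closed sets is equi-uniformly subsmooth if for every $\varepsilon>0$ there exists $\delta>0$ such that for all $t\in I$, $\langle\xi_2-\xi_1,x_2-x_1\rangle\ge-\varepsilon\|x_2-x_1\|$ holds for all $x_1,x_2\in S(t)$ with $\|x_1-x_2\|\le\delta$ and all $\xi_i\in N(S(t);x_i)\cap\mathbb B$, $i\in\{1,2\}$.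 Approximate projections. For $\varepsilon>0$, $\operatorname{proj}_S^{\varepsilon}(x):=\{z\in S:\|x-z\|^2<d_S^2(x)+\varepsilon\}$. For $\varepsilon,\eta>0$, $\operatorname{proj}_S^{\varepsilon,\eta}(x):=\{z\in S_\eta:\|x-z\|^2<d_S^2(x)+\varepsilon\}$, where $S_\eta$ is any (arbitrarily chosen) closed set with $S\subset S_\eta\subset S+\eta\mathbb B$. Inexact catching-up algorithm. For $n\in\mathbb N$, $n\ge1$, let $t_k^n:=kT/n$, $k=0,\dots,n$, and $\mu_n:=T/n$. Put $x_0^n=x_0$ and, for $k\in\{0,\dots,n-1\}$, choose $$x_{k+1}^n\in\operatorname{proj}_{C(t_{k+1}^n)}^{\varepsilon_n,\eta_n}\Big(x_k^n+\int_{t_k^n}^{t_{k+1}^n}f(s,x_k^n)\,\mathrm ds\Big).$$ Define $x_n(0)=x_0$ and, for $t\in\,]t_k^n,t_{k+1}^n]$, $$x_n(t)=x_k^n+\frac{t-t_k^n}{\mu_n}\Big(x_{k+1}^n-x_k^n-\int_{t_k^n}^{t_{k+1}^n}f(s,x_k^n)\,\mathrm ds\Big)+\int_{t_k^n}^tf(s,x_k^n)\,\mathrm ds.$$ A solution of the differential inclusion is an absolutely continuous function $x\colon[0,T]\to\mathcal H$ with $x(0)=x_0$ satisfying the inclusion for a.e. $t\in[0,T]$. *)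

(* Defs.v *)
From HB Require Import structures.
From mathcomp Require Import all_boot all_order all_algebra.
From mathcomp Require Import all_classical all_reals all_analysis.
Import Order.TTheory GRing.Theory Num.Theory.
Import numFieldNormedType.Exports.

Set Implicit Arguments.
Unset Strict Implicit.
Unset Printing Implicit Defensive.

Local Open Scope classical_set_scope.
Local Open Scope ring_scope.

(* A real Hilbert space is a completeNormedModType H over a realType together
   with a positive definite symmetric bilinear form dot : {dot H for idfun}
   that induces the norm of H. *)

Section Metric.
Context {R : realType} {H : normedModType R}.
Implicit Types (S A B : set H) (x : H).

Definition cball (r : R) : set H := [set x | `|x| <= r].

(* Extended-real valued, so that the distance to the empty set is +oo. *)
Definition dist S x : \bar R := ereal_inf [set `|x - z|%:E | z in S].

Definition Haus A B : \bar R :=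
  Order.max (ereal_sup [set dist B x | x in A])
            (ereal_sup [set dist A x | x in B]).

Definition ball_compact S := forall r : R, 0 < r -> compact (S `&` cball r).

Definition approx_proj (eps : R) S x : set H :=
  [set z | S z /\ ((`|x - z| ^+ 2)%:E < dist S x ^+ 2 + eps%:E)%E].

(* The points that may be selected, over all choices of the closed set Seta. *)
Definition approx_proj_outer (eps eta : R) S x : set H :=
  [set z | exists Seta : set H,
    [/\ closed Seta, S `<=` Seta,
        Seta `<=` [set a + b | a in S & b in cball eta],
        Seta z & ((`|x - z| ^+ 2)%:E < dist S x ^+ 2 + eps%:E)%E]].

End Metric.

Section WeakTopology.
Context {R : realType} (H : normedModType R).

(* The coarsest topology for which all continuous linear functionals are
   continuous. *)
Definition weak_space : topologicalType :=
  sup_topology (fun l : {l : {linear H -> R^o} | continuous l} =>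
    Topological.on (initial_topology (sval l : H -> R^o))).

Definition weakly_closed (D : set H) := closed (D : set weak_space).

Definition weak_usc (G : H -> set H) :=
  forall D : set H, weakly_closed D -> closed [set x | G x `&` D !=set0].

End WeakTopology.

Section Clarke.
Context {R : realType} {H : normedModType R} (dot : {dot H for idfun}).
Implicit Types (S : set H) (x : H).

Definition clarke_tangent S x : set H :=
  [set h | forall (xs : nat -> H) (ts : nat -> R),
    (forall n, S (xs n)) -> xs @ \oo --> x ->
    (forall n, 0 < ts n) -> ts @ \oo --> (0 : R) ->
    exists hs : nat -> H,
      hs @ \oo --> h /\ forall n, S (xs n + ts n *: hs n)].

Definition clarke_normal S x : set H :=
  [set v | S x /\ forall h, clarke_tangent S x h -> dot v h <= 0].

Definition equi_uniformly_subsmooth (I : set R) (C : R -> set H) :=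
  forall eps : R, 0 < eps -> exists2 delta : R, 0 < delta &
    forall t, I t -> forall x1 x2, C t x1 -> C t x2 -> `|x1 - x2| <= delta ->
    forall xi1 xi2,
      (clarke_normal (C t) x1 `&` cball 1) xi1 ->
      (clarke_normal (C t) x2 `&` cball 1) xi2 ->
      - eps * `|x2 - x1| <= dot (xi2 - xi1) (x2 - x1).

End Clarke.

Section Bochner.
Context {R : realType} {H : normedModType R}.
Local Notation mu := (@lebesgue_measure R).
Implicit Types (D : set R) (f s : R -> H).

Definition simple_fun s :=
  finite_set (range s) /\ forall v : H, measurable (s @^-1` [set v]).

(* Only meant for D of finite measure. *)
Definition simple_integral D s : H :=
  \sum_(v \in range s) fine (mu (D `&` s @^-1` [set v])) *: v.

(* Bochner measurability: limit almost everywhere of simple functions.  As the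
   limit is only required almost everywhere, Borel level sets in simple_fun
   give the same class of functions f as Lebesgue measurable ones. *)
Definition strongly_measurable D f :=
  exists s : nat -> R -> H, (forall n, simple_fun (s n)) /\
    {ae mu, forall t, D t -> s n t @[n --> \oo] --> f t}.

Definition is_bochner_integral D f (v : H) :=
  strongly_measurable D f /\
  exists s : nat -> R -> H,
    [/\ forall n, simple_fun (s n),
        (\int[mu]_(t in D) `|f t - s n t|%:E)%E @[n --> \oo] --> (0 : \bar R) &
        simple_integral D (s n) @[n --> \oo] --> v].

Definition bochner_integral (a b : R) f : H :=
  xget 0 [set v | is_bochner_integral `[a, b] f v].

End Bochner.

Section SweepingProcess.
Context {R : realType} {H : normedModType R}.
Local Notation mu := (@lebesgue_measure R).

Definition absolutely_continuous_on (a b : R) (x : R -> H) :=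
  forall eps : R, 0 < eps -> exists2 delta : R, 0 < delta &
    forall (m : nat) (u v : 'I_m -> R),
      (forall i, [/\ a <= u i, u i <= v i & v i <= b]) ->
      trivIset setT (fun i => `]u i, v i[%classic) ->
      \sum_(i < m) (v i - u i) < delta ->
      \sum_(i < m) `|x (v i) - x (u i)| < eps.

(* x' \in - N(C(t); x) + F(t, x) a.e. on [0, T] and x(0) = x0.  The values of x
   outside [0, T] are irrelevant. *)
Definition sweeping_solution (dot : {dot H for idfun}) (T : R)
    (C : R -> set H) (F : R -> H -> set H) (x0 : H) (x : R -> H) :=
  [/\ absolutely_continuous_on 0 T x, x 0 = x0 &
      {ae mu, forall t : R, `[0, T]%classic t ->
        derivable x t 1 /\
        [set - v + w | v in clarke_normal dot (C t) (x t) & w in F t (x t)]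
          (derive1 x t)}].

Definition tnode (T : R) (n k : nat) : R := k%:R * T / n%:R.

Definition inexact_catching_up (T : R) (C : R -> set H) (f : R -> H -> H)
    (x0 : H) (n : nat) (eps eta : R) (x : R -> H) :=
  exists xs : nat -> H,
    [/\ xs 0%N = x0,
        forall k, (k < n)%N ->
          approx_proj_outer eps eta (C (tnode T n k.+1))
            (xs k + bochner_integral (tnode T n k) (tnode T n k.+1) (f ^~ (xs k)))
            (xs k.+1),
        x 0 = x0 &
        forall k t, (k < n)%N -> tnode T n k < t <= tnode T n k.+1 ->
          x t = xs k
            + ((t - tnode T n k) / (T / n%:R)) *:
                (xs k.+1 - xs k
                 - bochner_integral (tnode T n k) (tnode T n k.+1) (f ^~ (xs k)))
            + bochner_integral (tnode T n k) t (f ^~ (xs k))].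

End SweepingProcess.

(* Main.v *)
Require Import Defs.
From HB Require Import structures.
From mathcomp Require Import all_boot all_order all_algebra.
From mathcomp Require Import all_classical all_reals all_analysis.
From mathcomp Require Import measurable_realfun.
From mathcomp Require Import ring lra.
(** The interpolations [xn n] have a derivative of the form [drift - thrust]:
    the drift is the field [f] frozen at the last node, the thrust
    is the displacement made by the approximate projection, divided by the step.

    Uniform bounds.  The projected point is not much farther from [x_k + int f] than
    the nearest point of [C (t_k.+1)], which lies within [O (step)] because [C] is
    Lipschitz; with the linear growth of [f] and Gronwall's inequality, drift and
    thrust are bounded independently of [n] ([scheme_velocity]).  The curves are thus
    equi-Lipschitz, they approach the ball-compact sets [C t], and a subsequence
    converges uniformly to some [x] with [x t] in [C t] ([equilipschitz_limit]).

    Normals.  The projection is only approximate, but an [e]-minimiser of the distance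
    to a ball-compact set lies within [sqrt e] of a point carrying an exact proximal
    normal close to the displacement ([approx_projection_normal]).  As the tolerances
    are small against the step, the thrust is, up to [o (1)], a normal to
    [C (t_k.+1)] at a point close to [x t] ([thrust_normal]).

    Passage to the limit.  Instead of weak limits of the velocities, iterated midpoints
    of ever later drifts and thrusts with almost minimal mean square are used.  By the
    parallelogram identity they converge almost everywhere, to [v] and [z] say
    ([mazur_ae]).  The same midpoints of the curves still converge to [x], so [x] is a
    primitive of [v - z], and hence differentiable almost everywhere with that
    derivative ([increment_derivable], by Lebesgue's differentiation theorem applied to
    the distances of the velocity to a dense sequence).

    Inclusions.  At a fixed time, if [v t] were outside the closed convex set
    [F t (x t)], a half-space would separate them; by weak upper semicontinuity the
    late drifts would lie in that half-space, and so would their averages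
    ([weak_usc_mix]).  For [z t], equi-uniform subsmoothness gives normals the
    inequality [dot xi (y - xb) <= e * `|y - xb|] near their base point, uniformly in
    time; being affine in [xi], it is inherited by averages and limits, and it makes
    [z t] a normal to [C t] at [x t] ([normal_mix]).

    Bochner integrals and velocities are handled through scalar products with fixed
    vectors, which are integrals of real functions. *)

Import Order.TTheory GRing.Theory Num.Theory.
Import numFieldNormedType.Exports.
Set Implicit Arguments.
Unset Strict Implicit.
Unset Printing Implicit Defensive.
Local Open Scope classical_set_scope.
Local Open Scope ring_scope.

(** * Geometry of the Hilbert space *)

Lemma cvg_of_tail_bound {R : realType} {V : completeNormedModType R}
    (u : nat -> V) (e : nat -> R) :
  e @ \oo --> (0 : R) ->
  (forall N n, (N <= n)%N -> `|u N - u n| <= e N + e n) -> cvgn u.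
Proof.
move=> e0 ue; apply/cauchy_cvgP/cauchy_exP => r r0.
have r20 : 0 < r / 2 by rewrite divr_gt0.
have /cvgrPdist_lt/(_ _ r20)[N _ Nr] := e0.
exists (u N); exists N => // n /= Nn.
rewrite -ball_normE/=; apply: le_lt_trans (ue _ _ Nn) _.
have lt_r m : (N <= m)%N -> e m < r / 2.
  by move=> /Nr; rewrite /= sub0r normrN; apply: le_lt_trans; exact: ler_norm.
by rewrite [ltRHS]splitr ltrD// lt_r.
Qed.

Section Hilbert.
Context {R : realType} {H : completeNormedModType R} (dot : {dot H for idfun}).
Hypothesis norm_dot : forall x : H, dot x x = `|x| ^+ 2.
Implicit Types (x y z p : H) (S : set H).

Lemma dotC x y : dot x y = dot y x.
Proof. by rewrite hermC /= expr0 mul1r. Qed.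

Lemma dotDl x y z : dot (x + y) z = dot x z + dot y z.
Proof. exact: linearDl. Qed.
Lemma dotDr x y z : dot z (x + y) = dot z x + dot z y.
Proof. exact: linearDr. Qed.
Lemma dotBl x y z : dot (x - y) z = dot x z - dot y z.
Proof. exact: linearBl. Qed.
Lemma dotBr x y z : dot z (x - y) = dot z x - dot z y.
Proof. exact: linearBr. Qed.
Lemma dotZl (a : R) x y : dot (a *: x) y = a * dot x y.
Proof. exact: linearZl_LR. Qed.
Lemma dotZr (a : R) x y : dot x (a *: y) = a * dot x y.
Proof. by rewrite dotC dotZl dotC. Qed.
Lemma dot0l x : dot 0 x = 0.
Proof. exact: linear0l. Qed.
Lemma dot0r x : dot x 0 = 0.
Proof. exact: linear0r. Qed.
Lemma dotNl x y : dot (- x) y = - dot x y.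
Proof. exact: linearNl. Qed.

Lemma normD_sqr x y : `|x + y| ^+ 2 = `|x| ^+ 2 + 2 * dot x y + `|y| ^+ 2.
Proof.
by rewrite -!norm_dot dotDl !dotDr (dotC y x); ring.
Qed.

Lemma normB_sqr x y : `|x - y| ^+ 2 = `|x| ^+ 2 - 2 * dot x y + `|y| ^+ 2.
Proof.
by rewrite -!norm_dot dotBl !dotBr (dotC y x); ring.
Qed.

Lemma dot_le x y : dot x y <= `|x| * `|y|.
Proof.
have [->|x0] := eqVneq x 0; first by rewrite dot0l normr0 mul0r.
have [->|y0] := eqVneq y 0; first by rewrite dot0r normr0 mulr0.
have := sqr_ge0 (`| `|y| *: x - `|x| *: y |).
rewrite normB_sqr !normrZ !normr_id dotZl dotZr => h0.
have := h0; rewrite (_ : _ + _ = 2 * (`|x| * `|y|) * (`|x| * `|y| - dot x y)); last by ring.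
by rewrite pmulr_rge0 ?subr_ge0// !mulr_gt0// ?normr_gt0.
Qed.

Lemma normr_dot_le x y : `|dot x y| <= `|x| * `|y|.
Proof. by rewrite ler_norml dot_le andbT lerNl -dotNl (le_trans (dot_le _ _))// normrN. Qed.

(** Written with the midpoint of [x] and [y], since midpoints of near-minimisers
    are what the minimisation arguments below compare with. *)
Lemma parallelogram x y :
  `|x - y| ^+ 2 = 2 * `|x| ^+ 2 + 2 * `|y| ^+ 2 - 4 * `|2^-1 *: (x + y)| ^+ 2.
Proof.
rewrite normrZ normB_sqr exprMn normD_sqr ger0_norm// expr2; by field.
Qed.

Lemma continuous_dot p : continuous (fun x => dot x p : R^o).
Proof.
move=> x; apply/cvgrPdist_le => e e0.
have p1 : 0 < `|p| + 1 by rewrite ltr_wpDl.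
near=> y; rewrite -dotBl (le_trans (normr_dot_le _ _))//.
rewrite (@le_trans _ _ (e / (`|p| + 1) * (`|p| + 1)))//; last first.
  by rewrite divfK// gt_eqF.
rewrite ler_pM// ?lerDl//.
near: y; apply: cvgr_dist_le => //; exact: divr_gt0.
Unshelve. all: by end_near. Qed.

Lemma cvg_dot {T} (F : set_system T) {FF : Filter F} (u : T -> H) l p :
  u @ F --> l -> (dot (u t) p : R) @[t --> F] --> (dot l p : R).
Proof. by move=> ul; exact: (cvg_comp _ _ ul (@continuous_dot p l)). Qed.

Lemma cvg_dotr {T} (F : set_system T) {FF : Filter F} (u : T -> H) l p :
  u @ F --> l -> (dot p (u t) : R) @[t --> F] --> (dot p l : R).
Proof.
rewrite (_ : (fun t => dot p (u t)) = fun t => dot (u t) p).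
  by rewrite (dotC p); exact: cvg_dot.
by apply/funext => t; rewrite dotC.
Qed.

(** Each [dot ^~ p] is one of the functionals defining the weak topology. *)
Lemma weakly_closed_halfspace (a : R) p : weakly_closed [set w : H | a <= dot w p].
Proof.
pose l0 : {linear H -> R^o} := applyr dot p.
have l0c : continuous l0 by exact: continuous_dot.
pose l : {l : {linear H -> R^o} | continuous l} := exist _ l0 l0c.
rewrite /weakly_closed.
have c : continuous (fun x : weak_space H => dot x p : R^o).
  move=> x.
  pose Tc := fun l : {l : {linear H -> R^o} | continuous l} =>
    Topological.on (initial_topology (sval l : H -> R^o)).
  have h := (@cvg_sup H _ Tc (nbhs (x : weak_space H)) x _).1 (fun _ => id) l.
  move=> A /(@initial_continuous H R^o (l0 : H -> R^o) x).
  exact: h.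
apply: (@closed_comp (weak_space H) R^o (fun x => dot x p) [set r | a <= r]).
  by move=> x _; exact: c.
exact: closed_ge.
Qed.


(** A minimising sequence is Cauchy by the parallelogram identity. *)
Lemma closed_convex_nearest S x : S !=set0 -> closed S ->
  (forall y z, S y -> S z -> S (2^-1 *: (y + z))) ->
  exists2 z, S z & forall y, S y -> `|x - z| <= `|x - y|.
Proof.
move=> [s0 Ss0] Scl Smid.
pose D := [set `|x - y| | y in S]; pose d := inf D.
have D0 : D !=set0 by exists `|x - s0|, s0.
have lbD : has_lbound D by exists 0 => _ [y _ <-].
have dle y : S y -> d <= `|x - y| by move=> Sy; apply: ge_inf => //; exists y.
have d0 : 0 <= d by apply: lb_le_inf => // _ [y _ <-].
have ex (n : nat) : exists y, S y /\ `|x - y| <= d + n.+1%:R^-1.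
  have [_ [y Sy <-] yd] := inf_adherent (ltac:(by []) : 0 < (n.+1%:R^-1 : R)) (conj D0 lbD).
  by exists y; split => //; exact: ltW.
pose u n := sval (cid (ex n)).
have Su n : S (u n) by rewrite /u; case: cid => /= ? [].
have ud n : `|x - u n| <= d + n.+1%:R^-1 by rewrite /u; case: cid => /= ? [].
have main (N n m : nat) : (N <= n)%N -> (N <= m)%N ->
    `|u n - u m| ^+ 2 <= (8 * d + 4) * N.+1%:R^-1.
  move=> Nn Nm.
  have key : 4 * d ^+ 2 <= 4 * `|2^-1 *: ((x - u m) + (x - u n))| ^+ 2.
    rewrite ler_pM2l// lerXn2r ?nnegrE//.
    rewrite (_ : _ *: _ = x - 2^-1 *: (u m + u n)); first exact/dle/Smid.
    rewrite addrACA -opprD scalerBr; congr (_ - _).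
    by rewrite -mulr2n -[x *+ 2]scaler_nat scalerA mulVf// scale1r.
  have inv k : (N <= k)%N -> `|x - u k| <= d + N.+1%:R^-1.
    move=> Nk; rewrite (le_trans (ud _))// lerD2l lef_pV2 ?posrE//.
    by rewrite ler_nat ltnS.
  have e1 : N.+1%:R^-1 <= 1 :> R by rewrite invf_le1// ler1n.
  have e0 : 0 < N.+1%:R^-1 :> R by [].
  have sq k : (N <= k)%N -> `|x - u k| ^+ 2 <= (d + N.+1%:R^-1) ^+ 2.
    by move=> Nk; rewrite lerXn2r ?nnegrE ?inv// addr_ge0// ltW.
  rewrite (_ : u n - u m = (x - u m) - (x - u n)); last by rewrite opprB [RHS]addrC subrKA.
  rewrite parallelogram; move: (sq _ Nn) (sq _ Nm) e1 e0 key.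
  set e := N.+1%:R^-1; set A := `|x - u n| ^+ 2; set B := `|x - u m| ^+ 2.
  set C := 4 * `|_| ^+ 2; nra.
have : cvgn u.
  apply: (@cvg_of_tail_bound _ _ _
    (fun N => Num.sqrt ((8 * d + 4) * N.+1%:R^-1))).
    rewrite -[0]sqrtr0 -(mulr0 (8 * d + 4)).
    apply: continuous_cvg; first exact: sqrt_continuous.
    by apply: cvgMr; exact: cvg_harmonic.
  move=> N n Nn; rewrite -[leLHS]ger0_norm// -sqrtr_sqr (le_trans (y := Num.sqrt ((8 * d + 4) * N.+1%:R^-1)))//.
    by rewrite ler_sqrt ?main// mulr_ge0// addr_ge0// mulr_ge0.
  by rewrite lerDl sqrtr_ge0.
move=> /cvg_ex[z uz]; have Sz : S z.
  by apply: (@closed_cvg _ _ \oo _ u S Scl _ z uz); exact: nearW.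
exists z => // y Sy; apply: le_trans (dle _ Sy).
have e0 : d + n.+1%:R^-1 @[n --> \oo] --> d.
  by rewrite -{2}[d]addr0; apply: cvgD; [exact: cvg_cst|exact: cvg_harmonic].
have nu : `|x - u n| @[n --> \oo] --> `|x - z|.
  by apply: cvg_norm; apply: cvgB => //; exact: cvg_cst.
by apply: (ler_cvg_to nu e0); exact: nearW.
Qed.

(** The separating functional is [x - z], for [z] the point of [S] nearest to
    [x]. *)
Lemma closed_convex_separation S x : S !=set0 -> closed S ->
  (forall y z, S y -> S z -> forall t : R, 0 <= t <= 1 -> S (t *: y + (1 - t) *: z)) ->
  ~ S x -> exists p a, (forall y, S y -> dot y p <= a) /\ a < dot x p.
Proof.
move=> S0 Scl Sconv Sx.
have [z Sz zmin] : exists2 z, S z & forall y, S y -> `|x - z| <= `|x - y|.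
  apply: closed_convex_nearest => // y z Sy Sz.
  have := Sconv _ _ Sy Sz 2^-1; rewrite (_ : 1 - 2^-1 = 2^-1); last by field.
  by rewrite scalerDr; apply; rewrite invr_ge0 ler0n invf_le1// ler1n.
exists (x - z), (dot z (x - z)); split=> [y Sy|]; last first.
  rewrite -subr_gt0 -dotBl norm_dot exprn_gt0// normr_gt0 subr_eq0.
  by apply/eqP => xz; apply: Sx; rewrite xz.
(* moving from [z] towards [y] cannot decrease the distance to [x] *)
have step (t : R) : 0 < t -> t <= 1 ->
    2 * dot (y - z) (x - z) <= t * `|y - z| ^+ 2.
  move=> t0 t1; have := zmin _ (Sconv _ _ Sy Sz t (ltac:(by rewrite ltW))).
  rewrite (_ : x - (_ + _) = (x - z) - t *: (y - z)); last first.
    by rewrite scalerBl scale1r scalerBr -addrA -opprD addrCA.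
  move=> h; have : `|x - z| ^+ 2 <= `|x - z - t *: (y - z)| ^+ 2.
    by rewrite lerXn2r// nnegrE.
  rewrite [leRHS]normB_sqr normrZ dotZr (dotC (x - z)) (gtr0_norm t0) exprMn.
  nra.
rewrite -subr_le0 -dotBl leNgt; apply/negP => c0.
set c := dot _ _ in step c0; set q := `|y - z| ^+ 2 in step.
have q0 : 0 <= q by exact: sqr_ge0.
have h0 : 0 < c / (c + q) by rewrite divr_gt0// ltr_wpDr.
have h1 : c / (c + q) <= 1 by rewrite ler_pdivrMr ?mul1r ?lerDl// ltr_wpDr.
have := step _ h0 h1; rewrite mulrAC ler_pdivlMr; nra.
Qed.

End Hilbert.

(** * Normal cones, iterated midpoints and their limits *)

Section Normals.
Context {R : realType} {H : completeNormedModType R} (dot : {dot H for idfun}).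
Hypothesis norm_dot : forall x : H, dot x x = `|x| ^+ 2.
Implicit Types (x y z v : H) (S : set H).

Lemma clarke_normal0 S x : S x -> clarke_normal dot S x 0.
Proof. by move=> Sx; split=> // k _; rewrite dot0l. Qed.

Lemma clarke_normalZ S x v (a : R) : 0 <= a ->
  clarke_normal dot S x v -> clarke_normal dot S x (a *: v).
Proof. by move=> a0 [Sx xv]; split=> // k /xv vk; rewrite dotZl mulr_ge0_le0. Qed.

(** In the definition of the tangent cone, the constant sequence [x] is a legal
    choice of base points: a tangent direction [k] then gives points
    [x + t *: k'] of [S] with [k'] close to [k], and the Frechet inequality bounds
    [dot v k] by [e * `|k|] for every [e]. *)
Lemma frechet_clarke_normal S x v : S x ->
  (forall e : R, 0 < e -> exists2 d : R, 0 < d &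
     forall z, S z -> `|z - x| <= d -> dot v (z - x) <= e * `|z - x|) ->
  clarke_normal dot S x v.
Proof.
move=> Sx vS; split=> // k /(_ (fun=> x) (@harmonic R)).
case=> //; [exact: cvg_cst|by move=> n; exact: harmonic_gt0|exact: cvg_harmonic|].
move=> hs [hsk hsS].
suff main (e : R) : 0 < e -> dot v k <= e * `|k|.
  rewrite leNgt; apply/negP => vk0.
  have k0 : 0 < `|k| + 1 by rewrite ltr_wpDl.
  have := main _ (divr_gt0 vk0 k0).
  rewrite mulrAC ler_pdivlMr// leNgt mulrDr mulr1 => /negP; apply.
  by rewrite ltrDl.
move=> e0; have [d d0 dS] := vS _ e0.
have small : harmonic n *: hs n @[n --> \oo] --> (0 : H).
  by rewrite -(scale0r k); apply: cvgZ => //; exact: cvg_harmonic.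
have cl : (dot v (hs n) : R) @[n --> \oo] --> (dot v k : R).
  exact: (cvg_dotr norm_dot).
have cr : e * `|hs n| @[n --> \oo] --> e * `|k|.
  by apply: cvgMr; exact: cvg_norm.
apply: (ler_cvg_to cl cr).
have := small => /cvgrPdist_le/(_ _ d0); apply: filterS => n.
rewrite sub0r normrN => nd.
have := dS _ (hsS n); rewrite addrAC subrr add0r => /(_ nd).
rewrite dotZr normrZ mulrCA gtr0_norm ?harmonic_gt0//.
by rewrite ler_pM2l// harmonic_gt0.
Qed.

(** A quadratic bound is a Frechet bound near [x]. *)
Lemma proximal_clarke_normal S x v (c : R) : S x ->
  (forall z, S z -> dot v (z - x) <= c * `|z - x| ^+ 2) -> clarke_normal dot S x v.
Proof.
move=> Sx vS; apply: frechet_clarke_normal => // e e0.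
have c0 : 0 < `|c| + 1 by rewrite ltr_wpDl.
exists (e / (`|c| + 1)); first exact: divr_gt0.
move=> z Sz zx; apply: le_trans (vS _ Sz) _.
rewrite expr2 mulrA ler_wpM2r//.
rewrite (@le_trans _ _ ((`|c| + 1) * `|z - x|))//.
  by rewrite ler_wpM2r// (le_trans (ler_norm _))// lerDl.
by rewrite -ler_pdivlMl// mulrC.
Qed.

(** An [e]-minimiser [x'] of the distance from [y] to [S] is close to a point
    carrying an exact normal that is close to [y - x']: minimise
    [|y - z|^2 + |z - x'|^2] over [S].  This plays the role of the
    Borwein-Preiss variational principle; the minimiser [xb] is the point of [S]
    nearest to the midpoint of [y] and [x']. *)
Lemma approx_projection_normal S x' y (e : R) :
  ball_compact S -> S x' -> 0 <= e ->
  (forall z, S z -> `|y - x'| ^+ 2 <= `|y - z| ^+ 2 + e) ->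
  exists xb, [/\ S xb, `|xb - x'| ^+ 2 <= e &
    clarke_normal dot S xb ((y - xb) + (x' - xb))].
Proof.
move=> Sc Sx' e0 x'min.
pose g z := `|y - z| ^+ 2 + `|z - x'| ^+ 2.
pose r := `|x'| + `|y - x'| + 1.
have r0 : 0 < r by rewrite ltr_wpDl// addr_ge0.
have [xb /set_mem[Sxb _] xbmin] : exists2 c, c \in S `&` cball r &
    forall t, t \in S `&` cball r -> g c <= g t.
  apply: compact_EVT_min; [|exact: Sc|].
    by exists x'; split=> //; rewrite /cball/= /r -addrA lerDl addr_ge0.
  apply: continuous_subspaceT => z; rewrite /g.
  apply: cvgD; under eq_fun do rewrite expr2; rewrite expr2; apply: cvgM;
    apply: cvg_norm; apply: cvgB => //; exact: cvg_cst.
have gx' : g x' = `|y - x'| ^+ 2 by rewrite /g subrr normr0 expr0n/= addr0.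
have x'r : x' \in S `&` cball r.
  by apply/mem_set; split=> //; rewrite /cball/= /r -addrA lerDl addr_ge0.
have xbglob z : S z -> g xb <= g z.
  move=> Sz; have [zr|zr] := leP `|z| r.
    by apply: xbmin; apply/mem_set.
  apply: le_trans (xbmin _ x'r) _; rewrite gx' /g.
  rewrite -[leLHS]add0r lerD ?sqr_ge0// lerXn2r ?nnegrE//.
  have := ler_normD (z - x') x'; rewrite subrK => h; move: zr h; rewrite /r.
  by lra.
exists xb; split=> //.
  have := xbmin _ x'r; rewrite gx' /g => h.
  have := x'min _ Sxb; lra.
apply: (@proximal_clarke_normal _ _ _ 1) => // z Sz.
have := xbglob _ Sz; rewrite /g.
rewrite (_ : y - z = (y - xb) - (z - xb)); last by rewrite opprB addrA subrK.
rewrite (_ : z - x' = (z - xb) - (x' - xb)); last by rewrite opprB addrA subrK.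
rewrite (distrC xb x'); move: (y - xb) (z - xb) (x' - xb) => a b c.
rewrite !(normB_sqr norm_dot) dotDl (dotC dot b c); lra.
Qed.

End Normals.

Section Trees.

(** Finite iterated midpoints of the terms of a sequence: midpoints are all
    that the parallelogram identity asks for. *)
Inductive tree := leaf of nat | node of tree & tree.

Fixpoint mix {R : realType} {V : lmodType R} (a : nat -> V) (t : tree) : V :=
  match t with
  | leaf m => a m
  | node l r => 2^-1 *: (mix a l + mix a r)
  end.

Fixpoint leaves_ge (n : nat) (t : tree) : bool :=
  match t with
  | leaf m => (n <= m)%N
  | node l r => leaves_ge n l && leaves_ge n r
  end.

Lemma leaves_geW m n t : (m <= n)%N -> leaves_ge n t -> leaves_ge m t.
Proof.
move=> mn; elim: t => [k|l IHl r IHr] /=; first exact: leq_trans.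
by move=> /andP[/IHl -> /IHr ->].
Qed.

Context {R : realType}.

Lemma mix_ind {V : lmodType R} (P : set V) (a : nat -> V) n t :
  (forall x y, P x -> P y -> P (2^-1 *: (x + y))) ->
  (forall m, (n <= m)%N -> P (a m)) -> leaves_ge n t -> P (mix a t).
Proof.
move=> Pmid Pa; elim: t => [m|l IHl r IHr] /=; first exact: Pa.
by move=> /andP[/IHl Pl /IHr Pr]; exact: Pmid.
Qed.

Lemma mixB {V : lmodType R} (a b : nat -> V) t :
  mix (fun m => a m - b m) t = mix a t - mix b t.
Proof.
elim: t => //= l -> r ->.
by rewrite -scalerBr opprD addrACA.
Qed.

Lemma mix_ball {V : normedModType R} (a : nat -> V) (x : V) (e : R) n t :
  (forall m, (n <= m)%N -> `|x - a m| <= e) -> leaves_ge n t -> `|x - mix a t| <= e.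
Proof.
move=> ae; apply: (mix_ind (P := fun y => `|x - y| <= e)) => // y z xy xz.
rewrite (_ : x - _ = 2^-1 *: ((x - y) + (x - z))); last first.
  rewrite addrACA -opprD scalerBr; congr (_ - _).
  by rewrite -mulr2n -[x *+ 2]scaler_nat scalerA mulVf// scale1r.
rewrite normrZ ger0_norm// mulrC ler_pdivrMr// (le_trans (ler_normD _ _))//.
by rewrite mulr_natr mulr2n lerD.
Qed.

Lemma mix_cvg {V : normedModType R} (a : nat -> V) (x : V) (tau : nat -> tree) :
  (forall j, leaves_ge j (tau j)) -> a @ \oo --> x -> mix a (tau j) @[j --> \oo] --> x.
Proof.
move=> tauP ax; apply/cvgrPdist_le => e e0.
have /cvgrPdist_le/(_ _ e0)[N _ Na] := ax.
exists N => // j Nj; apply: (mix_ball (n := j)) => // m jm.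
by apply: Na; exact: leq_trans jm.
Qed.

End Trees.

Section Limits.
Context {R : realType} {H : completeNormedModType R} (dot : {dot H for idfun}).
Hypothesis norm_dot : forall x : H, dot x x = `|x| ^+ 2.

(** Half-spaces are closed and stable under midpoints, so they survive the
    passage to limits of averages of ever later terms. *)
Lemma mix_halfspace (b : nat -> H) (p v : H) (a : R) (tau : nat -> tree) :
  (forall j, leaves_ge j (tau j)) -> mix b (tau j) @[j --> \oo] --> v ->
  (\forall m \near \oo, dot (b m) p <= a) -> dot v p <= a.
Proof.
move=> tauP bv [N _ Na].
have cl : (dot (mix b (tau j)) p : R) @[j --> \oo] --> (dot v p : R) by exact: cvg_dot.
have cr : (fun=> a : R) @ \oo --> a by exact: cvg_cst.
apply: (ler_cvg_to cl cr).
exists N => // j Nj; apply: (mix_ind (P := fun w => dot w p <= a) _ _ (tauP j)).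
  by move=> x y xa ya; rewrite dotZl dotDl; lra.
by move=> m jm; apply: Na; exact: leq_trans jm.
Qed.

(** A point outside [G x] is strictly separated from it by a half-space, which
    by weak upper semicontinuity still misses [G y] for [y] near [x]. *)
Lemma weak_usc_mix (G : H -> set H) (x v : H) (y b : nat -> H) (tau : nat -> tree) :
  weak_usc G -> G x !=set0 -> closed (G x) -> convex_set (G x) ->
  y @ \oo --> x -> (\forall m \near \oo, G (y m) (b m)) ->
  (forall j, leaves_ge j (tau j)) -> mix b (tau j) @[j --> \oo] --> v ->
  G x v.
Proof.
move=> Gusc G0 Gcl Gconv yx yb tauP bv; apply: contrapT => nGv.
have [|p [a [Ga av]]] := closed_convex_separation norm_dot G0 Gcl _ nGv.
  move=> z w Gz Gw t /andP[t0 t1].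
  have ti : Itv.spec (Itv.num_sem (R := R)) (Itv.Real `[0%Z, 1%Z]) t.
    by rewrite /= /Itv.num_sem/= num_real in_itv/= t0 t1.
  by have := Gconv z w (Itv.mk ti) (mem_set Gz) (mem_set Gw) => /set_mem.
pose c := (a + dot v p) / 2.
have ac : a < c by rewrite /c; lra.
have cv : c < dot v p by rewrite /c; lra.
have Dw : ~ [set z | G z `&` [set w | c <= dot w p] !=set0] x.
  by move=> [w [Gw /= /(lt_le_trans ac)]]; rewrite ltNge Ga.
have := Gusc _ (@weakly_closed_halfspace _ _ _ norm_dot c p).
move=> /closed_openC; rewrite openE => /(_ _ Dw) /yx near1.
have : dot v p <= c; last by rewrite leNgt cv.
apply: mix_halfspace tauP bv _; near=> m.
rewrite leNgt; apply/negP => /ltW cm.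
have : G (y m) (b m) by near: m; exact: yb.
have : (~` [set z | G z `&` [set w | c <= dot w p] !=set0]) (y m) by near: m; exact: near1.
by move=> h Gb; apply: h; exists (b m).
Unshelve. all: by end_near. Qed.

(** Closedness of the normal cones under averaging.  Subsmoothness, with one of
    the two normals equal to [0], says that a normal [xi] of norm at most [M] at
    [xb] satisfies [dot xi (y - xb) <= M * e * `|y - xb|] for [y] near [xb] in the
    same set.  This inequality is affine in [xi] and uniform in time.  Hence it
    passes to midpoints, to limits, and, through the Lipschitz dependence of [C]
    on time, to the limit set; there it makes the limit a Frechet normal. *)
Lemma normal_mix (I : set R) (C : R -> set H) (LC M t : R) (s : nat -> R)
    (x z0 : H) (xb xi zeta : nat -> H) (tau : nat -> tree) :
  equi_uniformly_subsmooth dot I C ->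
  (forall t s, I t -> I s -> forall z (e : R), C t z -> 0 < e ->
    exists2 z', C s z' & `|z - z'| <= LC * `|t - s| + e) ->
  I t -> C t x -> (forall m, I (s m)) -> s @ \oo --> t ->
  xb @ \oo --> x -> (forall m, clarke_normal dot (C (s m)) (xb m) (xi m)) ->
  0 < M -> (forall m, `|xi m| <= M) ->
  (zeta m - xi m) @[m --> \oo] --> (0 : H) ->
  (forall j, leaves_ge j (tau j)) -> mix zeta (tau j) @[j --> \oo] --> z0 ->
  clarke_normal dot (C t) x z0.
Proof.
move=> Csub Clip It Ctx Is st xbx xiN M0 xiM zxi tauP zz0.
apply: (frechet_clarke_normal norm_dot) => // e0 e0_gt0.
pose e := e0 / M; have e_gt0 : 0 < e by rewrite divr_gt0.
have eM : M * e = e0 by rewrite /e mulrC divfK// gt_eqF.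
have [d d0 dC] := Csub _ e_gt0.
exists (d / 2); first by rewrite divr_gt0.
move=> z Cz zx; apply/ler_addgt0Pr => r r0.
have ex m : exists2 z', C (s m) z' & `|z - z'| <= LC * `|t - s m| + harmonic m.
  by apply: Clip => //; exact: harmonic_gt0.
pose zm m := sval (cid2 (ex m)).
have Czm m : C (s m) (zm m) by rewrite /zm; case: cid2.
have zzm m : `|z - zm m| <= LC * `|t - s m| + harmonic m by rewrite /zm; case: cid2.
have zmz : zm @ \oo --> z.
  apply/cvgrPdist_le => q q0.
  have : LC * `|t - s m| + harmonic m @[m --> \oo] --> (0 : R).
    rewrite -[0]addr0; apply: cvgD; last exact: cvg_harmonic.
    rewrite -(mulr0 LC); apply: cvgMr; rewrite -(normr0 R) -(subrr t).
    by apply: cvg_norm; apply: cvgB => //; exact: cvg_cst.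
  move=> /cvgrPdist_le/(_ _ q0); apply: filterS => m.
  by rewrite sub0r normrN => h; rewrite (le_trans (zzm _))// (le_trans (ler_norm _)).
(* [q] is small enough for the three error terms below to add up to at most [r] *)
pose K := e0 + M + M * 2 + `|z - x| + e0.
have K0 : 0 < K by rewrite /K; have := normr_ge0 (z - x); lra.
pose q := Num.min (d / 4) (r / K).
have q0 : 0 < q by rewrite lt_min !divr_gt0.
have qd : q <= d / 4 by rewrite ge_min lexx.
have qr : q * K <= r by rewrite -ler_pdivlMr// ge_min lexx orbT.
apply: (mix_halfspace tauP zz0); near=> m.
have h1 : `|z - zm m| <= q by near: m; exact: cvgr_dist_le.
have h2 : `|x - xb m| <= q by near: m; exact: cvgr_dist_le.
have h3 : `|zeta m - xi m| <= q.
  by rewrite -normrN -sub0r; near: m; exact: cvgr_dist_le.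
have zxq : `|zm m - xb m| <= `|z - x| + 2 * q.
  rewrite (_ : zm m - xb m = (z - x) + ((x - xb m) - (z - zm m))); last first.
    by rewrite opprB addrA subrKA [RHS]addrC subrKA.
  rewrite (le_trans (ler_normD _ _))// lerD2l (le_trans (ler_normB _ _))//; lra.
have key : dot (xi m) (zm m - xb m) <= e0 * (`|z - x| + 2 * q).
  have ball1 : cball 1 (M^-1 *: xi m).
    by rewrite /cball/= normrZ gtr0_norm ?invr_gt0// ler_pdivrMl// mulr1.
  have ball0 : cball 1 (0 : H) by rewrite /cball/= normr0.
  have xi1 : clarke_normal dot (C (s m)) (xb m) (M^-1 *: xi m).
    by apply: clarke_normalZ; rewrite ?invr_ge0 ?ltW.
  have near_d : `|xb m - zm m| <= d by rewrite distrC; move: zxq zx qd; lra.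
  have : - e * `|zm m - xb m| <= - (M^-1 * dot (xi m) (zm m - xb m)).
    rewrite (_ : - (M^-1 * _) = dot (0 - M^-1 *: xi m) (zm m - xb m)); last first.
      by rewrite sub0r dotNl dotZl.
    apply: (dC _ (Is m) (xb m) (zm m) _ (Czm m) near_d (M^-1 *: xi m) 0).
    - by case: (xiN m).
    - by [].
    - by split=> //; exact: clarke_normal0.
  rewrite mulNr lerN2 mulrC ler_pdivrMr// mulrAC (mulrC e) eM => /le_trans; apply.
  by rewrite ler_pM2l.
rewrite (_ : dot (zeta m) (z - x) = dot (xi m) (zm m - xb m) +
    dot (xi m) ((z - zm m) - (x - xb m)) + dot (zeta m - xi m) (z - x)); last first.
  by rewrite dotBl -dotDr !dotBr; ring.
have b2 : dot (xi m) ((z - zm m) - (x - xb m)) <= M * (2 * q).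
  rewrite (le_trans (dot_le norm_dot _ _))// ler_pM//.
  by rewrite (le_trans (ler_normB _ _))//; lra.
have b3 : dot (zeta m - xi m) (z - x) <= q * `|z - x|.
  by rewrite (le_trans (dot_le norm_dot _ _))// ler_wpM2r.
have : 0 <= q * M by rewrite mulr_ge0// ltW.
move: qr key b2 b3; rewrite /K; lra.
Unshelve. all: by end_near. Qed.

End Limits.

(** * Strongly measurable functions *)

Section SeparablyMeasurable.
Context {R : realType} {H : normedModType R}.
Implicit Types (u w : R -> H).

(** Pettis' characterisation of strong measurability. *)
Definition separably_measurable u :=
  (exists q : nat -> H, forall t (e : R), 0 < e -> exists j, `|u t - q j| < e) /\
  forall r : H, measurable_fun [set: R] (fun t => `|u t - r|).

Lemma sm_cst (c : H) : separably_measurable (fun=> c).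
Proof.
split; last by move=> r; exact: measurable_cst.
by exists (fun=> c) => t e e0; exists 0%N; rewrite subrr normr0.
Qed.

Lemma sm_norm u : separably_measurable u -> measurable_fun [set: R] (fun t => `|u t|).
Proof. by move=> [_ /(_ 0)]; under eq_fun do rewrite subr0. Qed.

(** The distance from [u t + w t] to [r] is an infimum over the dense sequence [q]
    of sums of two measurable distances. *)
Lemma sm_add u w : separably_measurable u -> separably_measurable w ->
  separably_measurable (fun t => u t + w t).
Proof.
move=> [[q uq] mu_] [[p wp] mw]; split.
  exists (fun k => if unpickle k is Some ij then q ij.1 + p ij.2 else 0) => t e e0.
  have e20 : 0 < e / 2 by rewrite divr_gt0.
  have [i ui] := uq t _ e20; have [j wj] := wp t _ e20.
  exists (pickle (i, j)); rewrite pickleK/= opprD addrACA.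
  by rewrite (le_lt_trans (ler_normD _ _))// [ltRHS]splitr ltrD.
move=> r.
pose h j t := `|u t - q j| + `|w t - (r - q j)|.
have h_ge j t : `|u t + w t - r| <= h j t.
  rewrite /h (le_trans _ (ler_normD _ _))// opprB.
  by rewrite addrACA addKr.
rewrite (_ : (fun t => _) = fun t => infs (h ^~ t) 0).
  apply: measurable_fun_infs.
    by move=> t _; exists 0 => _ [j _ <-]; rewrite addr_ge0.
  by move=> j; apply: measurable_funD.
apply/funext => t; apply/eqP; rewrite eq_le; apply/andP; split.
  apply: lb_le_inf; first by exists (h 0%N t), 0%N.
  by move=> _ [j _ <-].
apply/ler_addgt0Pr => e e0.
have e20 : 0 < e / 2 by rewrite divr_gt0.
have [j uj] := uq t _ e20.
apply: (@le_trans _ _ (h j t)).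
  apply: ge_inf; last by exists j.
  by exists 0 => _ [k _ <-]; rewrite addr_ge0.
rewrite /h (_ : w t - (r - q j) = (u t + w t - r) - (u t - q j)); last first.
  rewrite !opprB [u t + _]addrC -!addrA; congr (_ + _).
  by rewrite [RHS]addrC -addrA subrK addrC.
have := ler_normB (u t + w t - r) (u t - q j); lra.
Qed.

Lemma sm_scale (a : R) u : separably_measurable u ->
  separably_measurable (fun t => a *: u t).
Proof.
have [->|a0] := eqVneq a 0.
  by move=> _; under eq_fun do rewrite scale0r; exact: sm_cst.
move=> [[q uq] mu_]; split.
  exists (fun j => a *: q j) => t e e0.
  have [j uj] := uq t (e / `|a|) (ltac:(by rewrite divr_gt0// normr_gt0)).
  by exists j; rewrite -scalerBr normrZ mulrC -ltr_pdivlMr// normr_gt0.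
move=> r; rewrite (_ : (fun t => _) = fun t => `|a| * `|u t - a^-1 *: r|).
  by apply: measurable_funM; [exact: measurable_cst|exact: mu_].
by apply/funext => t; rewrite -normrZ scalerBr scalerA mulfV// scale1r.
Qed.

Lemma sm_opp u : separably_measurable u -> separably_measurable (fun t => - u t).
Proof. by move=> /(sm_scale (-1)); under eq_fun do rewrite scaleN1r. Qed.

Lemma sm_sub u w : separably_measurable u -> separably_measurable w ->
  separably_measurable (fun t => u t - w t).
Proof. by move=> mu_ /sm_opp; exact: sm_add. Qed.

Lemma sm_indic (A : set R) u : measurable A -> separably_measurable u ->
  separably_measurable (fun t => (\1_A t : R) *: u t).
Proof.
move=> mA [[q uq] mu_]; split.
  exists (fun j => if j is k.+1 then q k else 0) => t e e0.
  rewrite indicE; case: (t \in A); last by exists 0%N; rewrite scale0r subrr normr0.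
  by have [j uj] := uq t e e0; exists j.+1; rewrite scale1r.
move=> r; rewrite (_ : (fun t => _) = fun t => \1_A t * `|u t - r| + (1 - \1_A t) * `|r|).
  apply: measurable_funD; apply: measurable_funM => //.
  by apply: measurable_funB => //.
apply/funext => t; rewrite indicE; case: (t \in A).
  by rewrite scale1r mul1r subrr mul0r addr0.
by rewrite scale0r sub0r normrN mul0r subr0 mul1r add0r.
Qed.

Lemma sm_lim (un : nat -> R -> H) u : (forall n, separably_measurable (un n)) ->
  (forall t, un n t @[n --> \oo] --> u t) -> separably_measurable u.
Proof.
move=> mun unu; split.
  pose q n := sval (cid (mun n).1).
  have qP n t (e : R) : 0 < e -> exists j, `|un n t - q n j| < e.
    by rewrite /q; case: cid => /= qn; apply.
  exists (fun k => if unpickle k is Some ij then q ij.1 ij.2 else 0) => t e e0.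
  have e20 : 0 < e / 2 by rewrite divr_gt0.
  have /cvgrPdist_lt/(_ _ e20)[n _ nu] := unu t.
  have [j uj] := qP n t _ e20.
  exists (pickle (n, j)); rewrite pickleK/= -(subrKA (un n t)).
  by rewrite (le_lt_trans (ler_normD _ _))// [ltRHS]splitr ltrD// nu/=.
move=> r; apply: (measurable_fun_cvg (h := fun n t => `|un n t - r|)).
  by move=> n; exact: (mun n).2.
by move=> t _; apply: cvg_norm; apply: cvgB => //; exact: cvg_cst.
Qed.

Lemma sm_sum (I : Type) (l : seq I) (U : I -> R -> H) :
  (forall i, separably_measurable (U i)) ->
  separably_measurable (fun t => \sum_(i <- l) U i t).
Proof.
move=> mU; elim: l => [|i l IH].
  by under eq_fun do rewrite big_nil; exact: sm_cst.
by under eq_fun do rewrite big_cons; exact: sm_add.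
Qed.

Lemma sm_mix (un : nat -> R -> H) (tr : tree) : (forall n, separably_measurable (un n)) ->
  separably_measurable (fun t => mix (un ^~ t) tr).
Proof.
move=> mun; elim: tr => [m|l IHl r IHr] /=; first exact: mun.
by apply: sm_scale; exact: sm_add.
Qed.

Lemma sm_simple s : simple_fun s -> separably_measurable s.
Proof.
move=> [sfin ms]; split.
  have /finite_seqP[l rl] := sfin.
  exists (nth 0 l) => t e e0; have : (range s) (s t) by exists t.
  rewrite rl/= => stl; exists (index (s t) l).
  by rewrite nth_index// subrr normr0.
move=> r _ Y mY; rewrite setTI.
rewrite (_ : _ @^-1` Y =
    \bigcup_(v in range s `&` [set v | Y `|v - r|]) (s @^-1` [set v])).
  apply: fin_bigcup_measurable => //; exact: finite_setIl.
apply/seteqP; split=> [t Yt|t [v [_ Yv] sv]] /=.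
  by exists (s t) => //; split=> //; exists t.
by rewrite /preimage/= in sv; rewrite /= sv.
Qed.

End SeparablyMeasurable.

Section Scalarisation.
Context {R : realType} {H : completeNormedModType R} (dot : {dot H for idfun}).
Hypothesis norm_dot : forall x : H, dot x x = `|x| ^+ 2.

Lemma sm_dot (u : R -> H) p : separably_measurable u ->
  measurable_fun [set: R] (fun t => dot (u t) p : R).
Proof.
move=> mu_; rewrite (_ : (fun t => _) =
    fun t => 2^-1 * (`|u t| ^+ 2 + `|p| ^+ 2 - `|u t - p| ^+ 2)).
  apply: measurable_funM => //; apply: measurable_funB.
    apply: measurable_funD => //; apply: measurable_funX; exact: sm_norm.
  by apply: measurable_funX; exact: mu_.2.
apply/funext => t; rewrite (normB_sqr norm_dot); by field.
Qed.

End Scalarisation.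

(** * Comparison of integrals and simple functions *)

Section LowerIntegral.
Context {R : realType}.
Local Notation mu := (@lebesgue_measure R).
Import HBNNSimple.

(** The integral of a nonnegative function is a supremum over the measurable simple
    functions below it; setting such a simple function to [0] on the exceptional
    null set keeps its integral. *)
Lemma ge0_le_integral_ae (D : set R) (f g : R -> \bar R) : measurable D ->
  (forall t, D t -> (0 <= f t)%E) -> (forall t, D t -> (0 <= g t)%E) ->
  {ae mu, forall t, D t -> (f t <= g t)%E} ->
  (\int[mu]_(t in D) f t <= \int[mu]_(t in D) g t)%E.
Proof.
move=> mD f0 g0 [N [mN N0 fgN]].
rewrite !ge0_integralE//; apply: ge_ereal_sup => _ [h /= hf <-].
pose h' := proj_nnsfun h (measurableC mN).
have -> : sintegral mu h = sintegral mu h'.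
  rewrite -!integralT_nnsfun; apply: ae_eq_integral => //.
  - by apply/measurable_EFinP.
  - by apply/measurable_EFinP.
  exists N; split => // t /= /not_implyP[_]; apply: contra_notP => nNt.
  by rewrite /h'/= mindicE/= mem_set// mulr1.
apply: ereal_sup_ubound; exists h' => //= t.
rewrite /= mindicE patchE; have [Nt|nNt] := boolP (t \in ~` N); last first.
  by rewrite mulr0; case: ifPn => // /set_mem; exact: g0.
rewrite mulr1; move: (hf t); rewrite patchE; case: ifPn => // /set_mem Dt hft.
apply: le_trans hft _; apply: contrapT => nfg; move/set_mem : Nt; apply.
by apply: fgN => /= /(_ Dt).
Qed.

Lemma ae_impl (P Q : R -> Prop) : (forall t, P t -> Q t) ->
  {ae mu, forall t, P t} -> {ae mu, forall t, Q t}.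
Proof. 
move=> PQ; apply: filterS; last exact: PQ.
exact: (ae_filter_ringOfSetsType mu).
Qed.

Lemma ae_and (P Q : R -> Prop) : {ae mu, forall t, P t} -> {ae mu, forall t, Q t} ->
  {ae mu, forall t, P t /\ Q t}.
Proof. by move=> aP aQ; apply: (@filterI _ _ (ae_filter_ringOfSetsType mu)). Qed.

Lemma ge0_eq_integral_ae (D : set R) (f g : R -> \bar R) : measurable D ->
  (forall t, D t -> (0 <= f t)%E) -> (forall t, D t -> (0 <= g t)%E) ->
  {ae mu, forall t, D t -> f t = g t} ->
  (\int[mu]_(t in D) f t = \int[mu]_(t in D) g t)%E.
Proof.
move=> mD f0 g0 fg; apply/eqP; rewrite eq_le; apply/andP; split.
  by apply: ge0_le_integral_ae => //; apply: ae_impl fg => t h Dt; rewrite h.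
by apply: ge0_le_integral_ae => //; apply: ae_impl fg => t h Dt; rewrite h.
Qed.

Lemma bounded_integrable (D : set R) (u : R -> R) (M : R) :
  measurable D -> (mu D < +oo)%E -> measurable_fun [set: R] u ->
  (forall t, `|u t| <= M) -> mu.-integrable D (EFin \o u).
Proof.
move=> mD Dfin mu_ uM; apply: measurable_bounded_integrable => //.
  exact: measurable_funTS.
exists M; split; first exact: num_real.
by move=> x Mx t _ /=; apply: le_trans (uM t) _; exact: ltW.
Qed.

End LowerIntegral.

Section Bochner.
Context {R : realType} {H : completeNormedModType R} (dot : {dot H for idfun}).
Hypothesis norm_dot : forall x : H, dot x x = `|x| ^+ 2.
Local Notation mu := (@lebesgue_measure R).
Implicit Types (f g s : R -> H) (D : set R).

(** Off a null set [f] is the limit of simple functions; setting it to [0] on that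
    set and outside [D] gives a version that is measurable everywhere.  The
    predicate [P] carries further properties holding almost everywhere. *)
Lemma strongly_measurable_sm (D : set R) f (P : R -> Prop) : measurable D ->
  strongly_measurable D f -> {ae mu, forall t, D t -> P t} ->
  exists g, [/\ separably_measurable g,
    forall t, g t = f t /\ P t \/ g t = 0 &
    {ae mu, forall t, D t -> g t = f t}].
Proof.
move=> mD [s [ss sf]] aP.
have [N [mN N0 NP]] := ae_and sf aP.
have mA : measurable (D `\` N) by exact: measurableD.
have good t : (D `\` N) t -> s n t @[n --> \oo] --> f t /\ P t.
  move=> [Dt Nt]; apply: contrapT => h; apply: Nt; apply: NP => -[/(_ Dt) h1 /(_ Dt) h2].
  exact: h.
exists (fun t => (\1_(D `\` N) t : R) *: f t); split.
- apply: (@sm_lim _ _ (fun n t => (\1_(D `\` N) t : R) *: s n t)).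
    by move=> n; apply: sm_indic => //; exact: sm_simple.
  move=> t; rewrite indicE; have [At|_] := boolP (t \in D `\` N).
    under eq_fun do rewrite scale1r; rewrite scale1r.
    by have [] := good _ (set_mem At).
  by under eq_fun do rewrite scale0r; rewrite scale0r; exact: cvg_cst.
- move=> t; rewrite indicE; have [At|_] := boolP (t \in D `\` N).
    by left; rewrite scale1r; have [] := good _ (set_mem At).
  by right; rewrite scale0r.
exists N; split => // t /= /not_implyP[Dt]; apply: contra_notP => Nt.
by rewrite indicE mem_set// scale1r.
Qed.

Lemma simple_fun_bounded s : simple_fun s -> exists M : R, forall t, `|s t| <= M.
Proof.
move=> [/finite_seqP[l rl] _].
exists (\sum_(v <- l) `|v|) => t; have : (range s) (s t) by exists t.
rewrite rl/=; elim: l {rl} => // v l IH; rewrite inE big_cons.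
move=> /predU1P[->|/IH h]; last by rewrite (le_trans h)// lerDr.
by rewrite lerDl sumr_ge0.
Qed.

Lemma simple_fun_indic (A : set R) s : measurable A -> simple_fun s ->
  simple_fun (fun t => (\1_A t : R) *: s t).
Proof.
move=> mA [sfin ms]; split.
  apply: (@sub_finite_set _ _ (range s `|` [set 0])).
    move=> _ [t _ <-]; rewrite indicE; case: (t \in A); last by right; rewrite /= scale0r.
    by left; exists t => //; rewrite scale1r.
  by rewrite finite_setU; split=> //; exact: finite_set1.
move=> v.
rewrite (_ : _ @^-1` _ = (A `&` s @^-1` [set v]) `|` (~` A `&` [set t | 0 = v])).
  apply: measurableU; apply: measurableI => //; first exact: measurableC.
  have [->|v0] := pselect (0 = v).
    by rewrite (_ : [set _ | _] = setT)//; apply/seteqP; split.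
  by rewrite (_ : [set _ | _] = set0)//; apply/seteqP; split.
apply/seteqP; split=> t /=; rewrite /preimage/= indicE.
  have [At|nAt] := boolP (t \in A).
    by rewrite scale1r => <-; left; split=> //; exact: set_mem.
  by rewrite scale0r => <-; right; split=> // /mem_set; exact/negP.
by case=> -[]; [move=> /mem_set -> <-; rewrite scale1r|move=> nAt <-; rewrite memNset// scale0r].
Qed.

Lemma dot_sumr (I : Type) (l : seq I) (F : I -> H) p :
  dot (\sum_(i <- l) F i) p = \sum_(i <- l) dot (F i) p.
Proof. by elim: l => [|i l IH]; rewrite ?big_nil ?dot0l// !big_cons dotDl IH. Qed.

(** Scalar products turn Bochner integrals into Lebesgue integrals of real
    functions; simple functions come first. *)
Lemma simple_integral_dot (D : set R) s p : measurable D -> (mu D < +oo)%E ->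
  simple_fun s ->
  dot (simple_integral D s) p = \int[mu]_(t in D) (dot (s t) p : R).
Proof.
move=> mD Dfin ss; have [sfin ms] := ss.
have /finite_seqP[l rl] := sfin.
have ru : [set` undup l] = range s by rewrite rl; apply/seteqP; split => v /=; rewrite mem_undup.
rewrite /simple_integral -ru -fsbig_seq ?undup_uniq//.
rewrite dot_sumr.
transitivity (\sum_(v <- undup l) \int[mu]_(t in D) (dot v p * \1_(s @^-1` [set v]) t)).
  apply: eq_bigr => v _; rewrite dotZl RintegralZl//; last first.
    apply: (@bounded_integrable _ _ _ 1) => //.
    by move=> t; rewrite indicE; case: (_ \in _); rewrite ?normr1 ?normr0.
  rewrite mulrC; congr (_ * _).
  by rewrite /Rintegral (integral_indic mu mD (ms v)) classical_sets.setIC.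
transitivity (\int[mu]_(t in D) (\sum_(v <- undup l) dot v p * \1_(s @^-1` [set v]) t)).
  elim: (undup l) => [|v k IH].
    rewrite big_nil; under eq_Rintegral do rewrite big_nil.
    by rewrite Rintegral_cst// mul0r.
  rewrite big_cons; under [RHS]eq_Rintegral do rewrite big_cons.
  have mterm w : measurable_fun [set: R] (fun t => dot w p * \1_(s @^-1` [set w]) t : R).
    by apply: measurable_funM => //; apply: measurable_indic.
  have bterm w t : `|dot w p * \1_(s @^-1` [set w]) t| <= `|dot w p|.
    rewrite normrM indicE; case: (_ \in _); rewrite ?normr1 ?mulr1// normr0 mulr0.
    exact: normr_ge0.
  rewrite RintegralD//; first by rewrite IH.
    exact: bounded_integrable (bterm v).
  apply: (@bounded_integrable _ _ _ (\sum_(w <- k) `|dot w p|)) => //.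
    by apply: measurable_sum.
  by move=> t; rewrite (le_trans (ler_norm_sum _ _ _))// ler_sum.
apply: eq_Rintegral => t _.
have stl : s t \in undup l by move: ru => /seteqP[_ /(_ (s t))]; apply; exists t.
rewrite (bigD1_seq (s t))/= ?undup_uniq// big1 ?addr0.
  by rewrite indicE mem_set// mulr1.
move=> v /eqP vs; rewrite indicE memNset ?mulr0//.
by rewrite /preimage/= => sv; apply: vs.
Qed.

End Bochner.

(** * The Bochner integral through scalar products *)

Section Bochner.
Context {R : realType} {H : completeNormedModType R} (dot : {dot H for idfun}).
Hypothesis norm_dot : forall x : H, dot x x = `|x| ^+ 2.
Local Notation mu := (@lebesgue_measure R).
Implicit Types (f g s u : R -> H) (D : set R).

Lemma dot_integrable D u p (M : R) : measurable D -> (mu D < +oo)%E ->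
  separably_measurable u -> (forall t, `|u t| <= M) ->
  mu.-integrable D (EFin \o (fun t => dot (u t) p : R)).
Proof.
move=> mD Dfin mu_ uM; apply: (@bounded_integrable _ _ _ (M * `|p|)) => //.
  exact: (sm_dot norm_dot).
by move=> t; rewrite (le_trans (normr_dot_le norm_dot _ _))// ler_wpM2r.
Qed.

Lemma norm_integrable D u (M : R) : measurable D -> (mu D < +oo)%E ->
  separably_measurable u -> (forall t, `|u t| <= M) ->
  mu.-integrable D (EFin \o (fun t => `|u t|)).
Proof.
move=> mD Dfin mu_ uM; apply: (@bounded_integrable _ _ _ M) => //.
  exact: sm_norm.
by move=> t; rewrite normr_id.
Qed.

Lemma integral_dot_le D u p (M : R) : measurable D -> (mu D < +oo)%E ->
  separably_measurable u -> (forall t, `|u t| <= M) ->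
  `|\int[mu]_(t in D) (dot (u t) p : R)| <= `|p| * \int[mu]_(t in D) `|u t|.
Proof.
move=> mD Dfin mu_ uM; rewrite -RintegralZl//; last exact: norm_integrable uM.
have h := le_normr_Rintegral (mu := mu) mD (dot_integrable p mD Dfin mu_ uM).
apply: (le_trans h).
have ipn : mu.-integrable D (EFin \o (fun t => `|p| * `|u t|)).
  apply: (@bounded_integrable _ _ _ (`|p| * M)) => //.
    by apply: measurable_funM => //; exact: sm_norm.
  by move=> t; rewrite normrM !normr_id ler_wpM2l.
apply: le_Rintegral => //.
  apply: (@bounded_integrable _ _ _ (M * `|p|)) => //.
    by apply: measurableT_comp => //; exact: (sm_dot norm_dot).
  by move=> t; rewrite normr_id (le_trans (normr_dot_le norm_dot _ _))// ler_wpM2r.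
by move=> t _; rewrite mulrC; exact: normr_dot_le.
Qed.

(** A vector whose scalar products are integrals of those of [u] is bounded in
    norm through the choice [p := w]. *)
Lemma norm_le_integral D u w (M : R) : measurable D -> (mu D < +oo)%E ->
  separably_measurable u -> (forall t, `|u t| <= M) ->
  (forall p, dot w p = \int[mu]_(t in D) (dot (u t) p : R)) ->
  `|w| <= \int[mu]_(t in D) `|u t|.
Proof.
move=> mD Dfin mu_ uM wu; have [->|w0] := eqVneq w 0.
  by rewrite normr0; apply: Rintegral_ge0.
have w1 : 0 < `|w| by rewrite normr_gt0.
have := integral_dot_le w mD Dfin mu_ uM.
rewrite -wu norm_dot ger0_norm ?sqr_ge0// expr2.
by rewrite ler_pM2l.
Qed.

(** The approximating simple functions converge to [f] in mean, and taking scalar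
    products with [p] is Lipschitz. *)
Lemma bochner_dot D f g v (M : R) : measurable D -> (mu D < +oo)%E ->
  separably_measurable g -> (forall t, `|g t| <= M) ->
  {ae mu, forall t, D t -> g t = f t} ->
  is_bochner_integral D f v ->
  forall p, dot v p = \int[mu]_(t in D) (dot (g t) p : R).
Proof.
move=> mD Dfin mg gM gf [_ [s [ss sf sv]]] p.
have sm_s n : separably_measurable (s n) by exact: sm_simple.
have sb n : exists K, forall t, `|s n t| <= K by exact: simple_fun_bounded.
have sg : \int[mu]_(t in D) `|g t - s n t| @[n --> \oo] --> (0 : R).
  rewrite -[0]/(fine 0%E); apply: fine_cvg; apply: cvg_trans sf.
  apply: near_eq_cvg; apply: nearW => n; apply: ge0_eq_integral_ae => //.
  by apply: ae_impl gf => t h Dt; rewrite h.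
have cl : (dot (simple_integral D (s n)) p : R) @[n --> \oo] --> (dot v p : R).
  exact: cvg_dot.
have cr : (dot (simple_integral D (s n)) p : R) @[n --> \oo] -->
    \int[mu]_(t in D) (dot (g t) p : R).
  apply/cvgrPdist_le => e e0.
  have p1 : 0 < `|p| + 1 by rewrite ltr_wpDl.
  have ep : 0 < e / (`|p| + 1) by rewrite divr_gt0.
  have /cvgrPdist_le/(_ _ ep) := sg; apply: filterS => n.
  rewrite sub0r normrN => h.
  rewrite (simple_integral_dot dot)//.
  have [K sK] := sb n.
  rewrite -RintegralB//; [|exact: dot_integrable gM|exact: dot_integrable sK].
  under eq_Rintegral do rewrite -dotBl.
  have mgs := sm_sub mg (sm_s n).
  have gsK t : `|g t - s n t| <= M + K by rewrite (le_trans (ler_normB _ _))// lerD.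
  apply: le_trans (integral_dot_le p mD Dfin mgs gsK) _.
  apply: le_trans (_ : (`|p| + 1) * (e / (`|p| + 1)) <= e); last first.
    by rewrite mulrC divfK// gt_eqF.
  rewrite ler_pM// ?lerDl//; first exact: Rintegral_ge0.
  by rewrite (le_trans (ler_norm _)).
exact: cvg_unique cl cr.
Qed.

(** The integrals of the truncated simple functions form a Cauchy sequence, by
    dominated convergence applied to their distance to [g]. *)
Lemma bochner_exists D f g (M : R) : measurable D -> (mu D < +oo)%E ->
  strongly_measurable D f ->
  separably_measurable g -> (forall t, `|g t| <= M) ->
  {ae mu, forall t, D t -> g t = f t} ->
  exists v, is_bochner_integral D f v.
Proof.
move=> mD Dfin fsm mg gM gf; have [s0 [ss0 s0f]] := fsm.
(* truncating the simple functions makes dominated convergence applicable *)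
pose A n := [set t | `|s0 n t| <= M + 1].
have mA n : measurable (A n).
  rewrite -[A n]setTI; apply: (measurable_fun_le measurableT) => //.
  by apply: sm_norm; exact: sm_simple.
pose s n t := (\1_(A n) t : R) *: s0 n t.
have ss n : simple_fun (s n) by exact: simple_fun_indic.
have sm_s n : separably_measurable (s n) by exact: sm_simple.
have M0 : 0 <= M by rewrite (le_trans _ (gM 0)).
have sM n t : `|s n t| <= M + 1.
  rewrite /s indicE; have [/set_mem At|_] := boolP (t \in A n).
    by rewrite scale1r.
  by rewrite scale0r normr0 addr_ge0.
have sg : {ae mu, forall t, D t -> s n t @[n --> \oo] --> g t}.
  apply: ae_impl (ae_and s0f gf) => t [sft gft] Dt; rewrite gft//.
  have := sft Dt; rewrite -gft// => s0g.
  have near_A : \forall n \near \oo, `|s0 n t| <= M + 1.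
    have /cvgrPdist_le/(_ _ ltr01) := s0g; apply: filterS => n h.
    rewrite -[s0 n t](subKr (g t)) (le_trans (ler_normB _ _))// lerD//.
  apply: cvg_trans s0g; apply: near_eq_cvg; apply: filterS near_A => n h.
  by rewrite /s indicE mem_set// scale1r.
have mgs n := sm_sub mg (sm_s n).
have gsK n t : `|g t - s n t| <= M + (M + 1) by rewrite (le_trans (ler_normB _ _))// lerD.
have E n : (\int[mu]_(t in D) `|f t - s n t|%:E = \int[mu]_(t in D) `|g t - s n t|%:E)%E.
  apply: ge0_eq_integral_ae => //.
  by apply: ae_impl gf => t h Dt; rewrite h.
have int0 : (\int[mu]_(t in D) `|g t - s n t|%:E)%E @[n --> \oo] --> (0 : \bar R).
  have [] := @dominated_convergence _ _ R mu D mD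
     (fun n t => `|g t - s n t|%:E) (cst 0%E) (cst (M + (M + 1))%:E).
  - move=> n; apply/measurable_EFinP; apply: measurable_funTS.
    exact: sm_norm.
  - exact: measurable_cst.
  - apply: ae_impl sg => t h Dt; apply: cvg_EFin; first by near=> n.
    rewrite -[X in _ --> X](@normr0 _ H) -(subrr (g t)).
    by apply: cvg_norm; apply: cvgB; [exact: cvg_cst|exact: h].
  - by apply: (@bounded_integrable _ D (cst (M + (M+1))) `|M + (M + 1)|) => //.
  - by apply: aeW => t n Dt /=; rewrite normr_id lee_fin.
  by move=> _ _; rewrite integral0_eq.
pose J n := \int[mu]_(t in D) `|g t - s n t|.
have J0 : J @ \oo --> (0 : R).
  by rewrite -[0]/(fine 0%E); apply: fine_cvg.
have cs : cvgn (fun n => simple_integral D (s n)).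
  apply: (cvg_of_tail_bound J0) => n m _; set w := _ - _.
  have wint p : dot w p = \int[mu]_(t in D) (dot (s n t - s m t) p : R).
    rewrite /w dotBl !(simple_integral_dot dot)//.
    rewrite -RintegralB//; [|exact: dot_integrable (sM n)|exact: dot_integrable (sM m)].
    by under eq_Rintegral do rewrite -dotBl.
  have msm := sm_sub (sm_s n) (sm_s m).
  have smM t : `|s n t - s m t| <= (M + 1) + (M + 1).
    by rewrite (le_trans (ler_normB _ _))// lerD.
  apply: le_trans (norm_le_integral mD Dfin msm smM wint) _.
  have i1 := norm_integrable mD Dfin (mgs n) (gsK n).
  have i2 := norm_integrable mD Dfin (mgs m) (gsK m).
  rewrite /J -RintegralD//; apply: le_Rintegral => //.
  - exact: norm_integrable smM.
  - exact: integrableD i1 i2.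
  - move=> t _; rewrite -(subrKA (g t)) (le_trans (ler_normD _ _))//.
    by rewrite distrC.
have /cvg_ex[v sv] := cs; exists v; split=> //; exists s; split=> //.
by under eq_fun do rewrite E.
Unshelve. all: by end_near. Qed.

Lemma strongly_measurableS D D' f : D' `<=` D ->
  strongly_measurable D f -> strongly_measurable D' f.
Proof.
move=> DD' [s [ss sf]]; exists s; split=> //.
by apply: ae_impl sf => t h /DD'.
Qed.

Lemma bochner_integral_dot (a b : R) f g (M : R) :
  strongly_measurable `[a, b] f ->
  separably_measurable g -> (forall t, `|g t| <= M) ->
  {ae mu, forall t, `[a, b]%classic t -> g t = f t} ->
  forall p, dot (bochner_integral a b f) p = \int[mu]_(t in `[a, b]) (dot (g t) p : R).
Proof.
move=> fsm mg gM gf.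
have Dfin : (mu `[a, b]%classic < +oo)%E.
  by rewrite lebesgue_measure_itv/=; case: ifP => _; rewrite ltry.
have mD : measurable `[a, b]%classic by exact: measurable_itv.
have [v fv] := bochner_exists mD Dfin fsm mg gM gf.
apply: (bochner_dot mD Dfin mg gM gf).
exact: (xgetI (P := [set v | is_bochner_integral `[a, b] f v]) 0 fv).
Qed.

End Bochner.

(** * Primitives and their derivatives *)

Section Primitive.
Context {R : realType} {H : completeNormedModType R} (dot : {dot H for idfun}).
Hypothesis norm_dot : forall x : H, dot x x = `|x| ^+ 2.
Local Notation mu := (@lebesgue_measure R).
Implicit Types (u x : R -> H).

Lemma itv_cc_lty (a b : R) : (mu `[a, b]%classic < +oo)%E.
Proof. by rewrite lebesgue_measure_itv/=; case: ifP => _; rewrite ltry. Qed.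

Lemma Rintegral_itv_split (a b c : R) (g : R -> R) : a <= b -> b <= c ->
  mu.-integrable `[a, c] (EFin \o g) ->
  \int[mu]_(t in `[a, c]) g t = \int[mu]_(t in `[a, b]) g t + \int[mu]_(t in `[b, c]) g t.
Proof.
move=> ab bc ig; apply/eqP; rewrite addrC -subr_eq; apply/eqP.
rewrite Rintegral_itvB ?bnd_simp// Rintegral_itv_obnd_cbnd//.
apply: integrableS ig => //=.
by move=> t /=; rewrite !in_itv/= => /andP[bt ->]; rewrite andbT (le_trans ab)// ltW.
Qed.

(** The increment of [x] from [s] to [t] is the Pettis integral of [u], so that only
    integrals of real functions occur. *)
Definition increment x u (s t : R) :=
  forall p, dot (x t - x s) p = \int[mu]_(r in `[s, t]) (dot (u r) p : R).

Section Fixed.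
Variables (u : R -> H) (M : R).
Hypotheses (mu_ : separably_measurable u) (uM : forall t, `|u t| <= M).

Lemma increment_split (a b c : R) p : a <= b -> b <= c ->
  \int[mu]_(r in `[a, c]) (dot (u r) p : R) =
  \int[mu]_(r in `[a, b]) (dot (u r) p : R) + \int[mu]_(r in `[b, c]) (dot (u r) p : R).
Proof.
move=> ab bc; apply: Rintegral_itv_split => //.
by apply: (dot_integrable norm_dot) => //; exact: itv_cc_lty.
Qed.

Lemma increment_cat x (a b c : R) : a <= b -> b <= c ->
  increment x u a b -> increment x u b c -> increment x u a c.
Proof.
move=> ab bc xab xbc p; rewrite (increment_split _ ab bc) -xab -xbc.
by rewrite -dotDl [in RHS]addrC subrKA.
Qed.

Lemma increment_sub x (a b c : R) : a <= b -> b <= c ->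
  increment x u a b -> increment x u a c -> increment x u b c.
Proof.
move=> ab bc xab xac p; apply: (addrI (dot (x b - x a) p)).
by rewrite {2}xab -(increment_split _ ab bc) -xac -dotDl [in LHS]addrC subrKA.
Qed.

(** [norm_le_integral] for the velocity [u - q]. *)
Lemma increment_dist_le x (s t : R) (q : H) : s <= t -> increment x u s t ->
  `|x t - x s - (t - s) *: q| <= \int[mu]_(r in `[s, t]) `|u r - q|.
Proof.
move=> st xu.
have uqM r : `|u r - q| <= M + `|q| by rewrite (le_trans (ler_normB _ _))// lerD.
apply: (norm_le_integral norm_dot _ (itv_cc_lty s t) _ uqM) => //.
  by apply: sm_sub => //; exact: sm_cst.
move=> p; under eq_Rintegral do rewrite dotBl.
rewrite RintegralB//; last 2 first.
- by apply: (dot_integrable norm_dot) => //; exact: itv_cc_lty.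
- apply: (@dot_integrable _ _ _ norm_dot _ (cst q) p `|q|) => //; first exact: itv_cc_lty.
  exact: sm_cst.
rewrite -xu dotBl; congr (_ - _); rewrite Rintegral_cst//= lebesgue_measure_itv/= dotZl mulrC.
rewrite lte_fin; case: ltP => [//|ts]; last first.
by rewrite (_ : t = s) ?subrr//; apply/eqP; rewrite eq_le st ts.
Qed.

Lemma increment_lip x (s t : R) : s <= t -> increment x u s t ->
  `|x t - x s| <= M * (t - s).
Proof.
move=> st xu; have := increment_dist_le 0 st xu.
rewrite scaler0 subr0 => /le_trans; apply.
under eq_Rintegral do rewrite subr0.
apply: (@le_trans _ _ (\int[mu]_(r in `[s, t]) M)).
  apply: le_Rintegral => //.
  - by apply: (norm_integrable _ _ _ uM) => //; exact: itv_cc_lty.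
  - apply: (@bounded_integrable _ _ (cst M) `|M|) => //; exact: itv_cc_lty.
rewrite Rintegral_cst//= lebesgue_measure_itv/= lte_fin; case: ltP => // ts.
by rewrite mulr0 mulr_ge0 ?subr_ge0// (le_trans _ (uM 0)).
Qed.

End Fixed.

Lemma bounded_locally_integrable (g : R -> R) (M : R) : measurable_fun [set: R] g ->
  (forall t, `|g t| <= M) -> locally_integrable [set: R] g.
Proof.
move=> mg gM; split=> //; first exact: openT.
move=> K _ Kc.
have mK : measurable K by exact: compact_measurable.
have /integrableP[_] : mu.-integrable K (EFin \o g).
  by apply: bounded_integrable gM => //; exact: compact_finite_measure.
by [].
Qed.

(** Lebesgue points are taken for the countably many real functions
    [|u - q_j|]; the dense [q_j] then make the difference quotients converge in
    norm. *)
Lemma increment_derivable x u (M T : R) : separably_measurable u ->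
  (forall t, `|u t| <= M) ->
  (forall s t, 0 <= s -> s <= t -> t <= T -> increment x u s t) ->
  {ae mu, forall t, `[0, T]%classic t -> derivable x t 1 /\ derive1 x t = u t}.
Proof.
move=> mu_ uM xu; have [q uq] := mu_.1.
pose g j t := `|u t - q j|.
have mg j : measurable_fun [set: R] (g j) by exact: mu_.2.
have gM j t : `|g j t| <= M + `|q j|.
  by rewrite normr_id (le_trans (ler_normB _ _))// lerD.
have ig j (a b : R) : mu.-integrable `[a, b] (EFin \o g j).
  by apply: bounded_integrable (gM j) => //; exact: itv_cc_lty.
pose G j t := \int[mu]_(r in `[0, t]) g j r.
have aeG : {ae mu, forall t, forall j, 0 < t -> derivable (G j) t 1 /\ derive1 (G j) t = g j t}.
  apply: ae_foralln => j.
  have := @FTC1 R (g j) (BLeft 0) (fun y => ig j 0 y) (bounded_locally_integrable (mg j) (gM j)).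
  by apply: ae_impl => t h t0; exact: h.
have aeT : {ae mu, forall t, t <> 0 /\ t <> T}.
  apply: ae_and.
    exists [set 0]; split; [exact: measurable_set1|exact: lebesgue_measure_set1|].
    by move=> t /= /contrapT.
  exists [set T]; split; [exact: measurable_set1|exact: lebesgue_measure_set1|].
  by move=> t /= /contrapT.
apply: ae_impl (ae_and aeG aeT) => t [Gt [t0 tT]] /=.
rewrite in_itv/= => /andP[t0' tT'].
have {t0 t0'}t0 : 0 < t by rewrite lt_neqAle t0' andbT; apply/eqP => /esym.
have {tT tT'}tT : t < T by rewrite lt_neqAle tT' andbT; apply/eqP.
have bound j h : h != 0 -> 0 < t + h -> t + h < T ->
    `|h^-1 *: (x (h + t) - x t) - q j| <= h^-1 * (G j (h + t) - G j t).
  move=> h0 th0 thT; rewrite [h + t]addrC.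
  have -> : h^-1 *: (x (t + h) - x t) - q j = h^-1 *: (x (t + h) - x t - h *: q j).
    by rewrite [RHS]scalerBr scalerA mulVf// scale1r.
  rewrite normrZ normfV.
  have [hn|hp|/eqP] := ltgtP h 0; last by rewrite (negbTE h0).
    have tht : t + h <= t by rewrite gerDl ltW.
    have xi := xu _ _ (ltW th0) tht (ltW tT).
    have := increment_dist_le mu_ uM (q j) tht xi.
    rewrite (_ : t - (t + h) = - h); last by rewrite opprD addrA subrr add0r.
    rewrite (_ : x t - _ - _ = - (x (t + h) - x t - h *: q j)); last first.
      by rewrite opprD opprB opprK scaleNr opprK.
    rewrite normrN ltr0_norm// => le1.
    have -> : h^-1 * (G j (t + h) - G j t) = (- h)^-1 * (G j t - G j (t + h)).
      by rewrite invrN mulNr -mulrN opprB.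
    by rewrite ler_pM2l ?invr_gt0 ?oppr_gt0// /G (Rintegral_itv_split (ltW th0) tht)// [X in _ <= X]addrC addKr.
  have tht : t <= t + h by rewrite lerDl ltW.
  have xi := xu _ _ (ltW t0) tht (ltW thT).
  have := increment_dist_le mu_ uM (q j) tht xi.
  rewrite [t + h - t]addrC addKr => le1.
  rewrite gtr0_norm// ler_pM2l ?invr_gt0// /G (Rintegral_itv_split (ltW t0) tht)//.
  by rewrite [X in _ <= X]addrC addKr.
have main : h^-1 *: (x (h + t) - x t) @[h --> 0^'] --> u t.
  apply/cvgrPdist_le => e e0.
  have e40 : 0 < e / 4 by rewrite divr_gt0.
  have [j uj] := uq t _ e40.
  have [dG dGt] := Gt j t0.
  have cG : h^-1 *: (G j (h *: 1 + t) - G j t) @[h --> 0^'] --> g j t.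
    by rewrite -dGt derive1E; exact: dG.
  have /cvgrPdist_le/(_ _ e40) := cG => near_G.
  have m0 : 0 < Num.min t (T - t) by rewrite lt_min t0 subr_gt0.
  near=> h.
  have h0 : h != 0 by near: h; exact: nbhs_dnbhs_neq.
  have hG : `|g j t - h^-1 *: (G j (h *: 1 + t) - G j t)| <= e / 4 by near: h.
  have : `|h| < Num.min t (T - t).
    by near: h; exact: dnbhs0_lt.
  rewrite lt_min ltr_norml => /andP[/andP[th0 _] /(le_lt_trans (ler_norm h)) thT].
  have := bound j h h0; rewrite -ltrBlDl sub0r th0 -ltrBrDl thT => /(_ isT isT) hb.
  have {}hG : `|g j t - h^-1 * (G j (h + t) - G j t)| <= e / 4.
    by move: hG; rewrite [h *: 1]mulr1.
  rewrite -(subrKA (q j)) (le_trans (ler_normD _ _))// (distrC (q j)).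
  move: hG; rewrite ler_norml => /andP[hG1 hG2].
  have hu : `|u t - q j| <= e / 4 by exact: ltW.
  rewrite /g in hG1 hG2; lra.
split.
  apply/cvg_ex; exists (u t); under eq_fun do rewrite [_%:A]mulr1.
  exact: main.
rewrite derive1E; apply/cvg_lim => //; under eq_fun do rewrite [_%:A]mulr1.
exact: main.
Unshelve. all: by end_near. Qed.

End Primitive.

(** * Almost everywhere convergence of averages *)

Section Mazur.
Context {R : realType} {H : completeNormedModType R} (dot : {dot H for idfun}).
Hypothesis norm_dot : forall x : H, dot x x = `|x| ^+ 2.
Local Notation mu := (@lebesgue_measure R).

Lemma mix_bounded {V : normedModType R} (a : nat -> V) (M : R) tr :
  (forall n, `|a n| <= M) -> `|mix a tr| <= M.
Proof.
move=> aM; have := @mix_ball R V a 0 M 0 tr.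
rewrite sub0r normrN; apply; last by elim: tr => //= l -> r ->.
by move=> m _; rewrite sub0r normrN.
Qed.

Lemma increment_mix (x u : nat -> R -> H) (M s t : R) tr :
  (forall n, separably_measurable (u n)) -> (forall n t, `|u n t| <= M) ->
  (forall n, increment dot (x n) (u n) s t) ->
  increment dot (fun r => mix (x ^~ r) tr) (fun r => mix (u ^~ r) tr) s t.
Proof.
move=> mu_ uM xu p; elim: tr => [m|l IHl r IHr] /=; first exact: xu.
rewrite -scalerBr dotZl opprD addrACA dotDl IHl IHr.
have int tr : mu.-integrable `[s, t] (EFin \o (fun r => dot (mix (u ^~ r) tr) p : R)).
  apply: (@dot_integrable _ _ _ norm_dot _ _ p M) => //; first exact: itv_cc_lty.
    exact: sm_mix.
  by move=> r0; exact: mix_bounded.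
rewrite -RintegralD// -RintegralZl//; last exact: integrableD (int l) (int r).
by apply: eq_Rintegral => r0 _; rewrite dotZl dotDl.
Qed.

(** Dominated convergence, one scalar product at a time. *)
Lemma increment_lim (X U : nat -> R -> H) (x u : R -> H) (M s t : R) :
  (forall j, separably_measurable (U j)) -> (forall j r, `|U j r| <= M) ->
  separably_measurable u ->
  (forall j, increment dot (X j) (U j) s t) ->
  X j s @[j --> \oo] --> x s -> X j t @[j --> \oo] --> x t ->
  {ae mu, forall r, `[s, t]%classic r -> U j r @[j --> \oo] --> u r} ->
  increment dot x u s t.
Proof.
move=> mU UM mu_ XU Xs Xt Uu p.
have cl : (dot (X j t - X j s) p : R) @[j --> \oo] --> (dot (x t - x s) p : R).
  by apply: cvg_dot => //; exact: cvgB.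
have cr : (dot (X j t - X j s) p : R) @[j --> \oo] -->
    \int[mu]_(r in `[s, t]) (dot (u r) p : R).
  under eq_fun do rewrite XU.
  have M0 : 0 <= M by rewrite (le_trans _ (UM 0%N 0)).
  have mdot w : separably_measurable w ->
      measurable_fun `[s, t]%classic (fun r => (dot (w r) p : R)%:E).
    by move=> mw; apply/measurable_EFinP; apply: measurable_funTS; exact: (sm_dot norm_dot).
  have cvU : {ae mu, forall r, `[s, t]%classic r ->
      (dot (U j r) p : R)%:E @[j --> \oo] --> (dot (u r) p : R)%:E}.
    apply: ae_impl Uu => r h sr; apply: cvg_EFin; first by near=> n.
    by apply: cvg_dot => //; exact: h.
  have ic : mu.-integrable `[s, t] (cst (M * `|p|)%:E).
    apply: (@bounded_integrable _ _ (cst (M * `|p|)) `|M * `|p| |) => //.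
    exact: itv_cc_lty.
  have dom : {ae mu, forall r, forall j, `[s, t]%classic r ->
      (`|(dot (U j r) p : R)%:E| <= (cst (M * `|p|)%:E) r)%E}.
    apply: aeW => r j _ /=; rewrite lee_fin (le_trans (normr_dot_le norm_dot _ _))//.
    by rewrite ler_wpM2r.
  have [iu _ cv] := dominated_convergence (mu := mu) (measurable_itv `[s, t])
    (fun j => mdot _ (mU j)) (mdot _ mu_) cvU ic dom.
  apply: fine_cvg; rewrite fineK//; exact: integrable_fin_num iu.
exact: cvg_unique cl cr.
Unshelve. all: by end_near. Qed.


(** Steps of size [O (2 ^ - j)] telescope to a geometric tail. *)
Lemma halving_steps_cvg {V : completeNormedModType R} (v : nat -> V) (K : R) :
  (forall j, `|v j - v j.+1| <= K * (2 ^+ j)^-1) -> cvgn v.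
Proof.
move=> vK.
have K0 : 0 <= K by have := le_trans (normr_ge0 _) (vK 0%N); rewrite expr0 invr1 mulr1.
have tail N k : `|v N - v (N + k)%N| <= 2 * K * (2 ^+ N)^-1 - 2 * K * (2 ^+ (N + k))^-1.
  elim: k => [|k IH]; first by rewrite addn0 !subrr normr0.
  rewrite -(subrKA (v (N + k)%N)) (le_trans (ler_normD _ _))//.
  have := vK (N + k)%N; rewrite addnS exprS invfM; move: IH; lra.
apply: (@cvg_of_tail_bound _ _ _ (fun N => 2 * K * (2 ^+ N)^-1)).
  rewrite -(mulr0 (2 * K)); apply: cvgMr.
  under eq_fun do rewrite -exprVn.
  by apply: cvg_expr; rewrite ger0_norm ?invf_lt1 ?ltr1n.
move=> N n Nn; rewrite -{1}(subnKC Nn) (le_trans (tail _ _))//.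
have p0 k : 0 <= 2 * K * (2 ^+ k)^-1 by rewrite !mulr_ge0// invr_ge0 exprn_ge0.
by have := p0 (N + (n - N))%N; have := p0 n; lra.
Qed.

Section Energy.
Variables (a b : nat -> R -> H) (M T : R).
Hypotheses (ma : forall n, separably_measurable (a n))
  (mb : forall n, separably_measurable (b n))
  (aM : forall n t, `|a n t| <= M) (bM : forall n t, `|b n t| <= M).
Let D : set R := `[0, T]%classic.
Let mD : measurable D. Proof. exact: measurable_itv. Qed.
Let Dfin : (mu D < +oo)%E. Proof. exact: (itv_cc_lty 0 T). Qed.
Let A tr t := mix (a ^~ t) tr.
Let B tr t := mix (b ^~ t) tr.

(** The squared norm of the averaged pair in the space of square integrable
    functions; both sequences are averaged with the same tree. *)
Definition energy tr : R := \int[mu]_(t in D) (`|A tr t| ^+ 2 + `|B tr t| ^+ 2).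

Let integrable_sqr (u : R -> H) (K : R) : separably_measurable u ->
  (forall t, `|u t| <= K) -> mu.-integrable D (EFin \o (fun t => `|u t| ^+ 2)).
Proof.
move=> mu_ uK; apply: (@bounded_integrable _ _ _ (K ^+ 2)) => //.
  by apply: measurable_funX; exact: sm_norm.
move=> t; rewrite ger0_norm ?sqr_ge0//.
have K0 : 0 <= K by rewrite (le_trans _ (uK t)).
by rewrite lerXn2r ?nnegrE.
Qed.

Let mA tr : separably_measurable (A tr). Proof. exact: sm_mix. Qed.
Let mB tr : separably_measurable (B tr). Proof. exact: sm_mix. Qed.
Let AM tr t : `|A tr t| <= M. Proof. exact: mix_bounded. Qed.
Let BM tr t : `|B tr t| <= M. Proof. exact: mix_bounded. Qed.
Let iE tr : mu.-integrable D (EFin \o (fun t => `|A tr t| ^+ 2 + `|B tr t| ^+ 2)).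
Proof. exact: (integrableD (mu := mu) mD (integrable_sqr (mA tr) (AM tr)) (integrable_sqr (mB tr) (BM tr))). Qed.

Lemma energy_ge0 tr : 0 <= energy tr.
Proof. by apply: Rintegral_ge0 => t _; rewrite addr_ge0// sqr_ge0. Qed.

Let C := (M ^+ 2 + M ^+ 2) * fine (mu D).

Lemma energy_le tr : energy tr <= C.
Proof.
rewrite /C -Rintegral_cst//; apply: le_Rintegral => //.
  apply: (@bounded_integrable _ _ (cst (M ^+ 2 + M ^+ 2)) `|M ^+ 2 + M ^+ 2|) => //.
by move=> t _; rewrite lerD// lerXn2r ?nnegrE// (le_trans _ (AM tr t)).
Qed.

Lemma energy_parallelogram l r :
  \int[mu]_(t in D) (`|A l t - A r t| ^+ 2 + `|B l t - B r t| ^+ 2) =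
  2 * energy l + 2 * energy r - 4 * energy (node l r).
Proof.
have iZ (k : R) tr : mu.-integrable D (EFin \o (fun t => k * (`|A tr t| ^+ 2 + `|B tr t| ^+ 2))).
  exact: (integrableZl (mu := mu) mD k (iE tr)).
rewrite /energy -!RintegralZl//.
rewrite -RintegralD//.
rewrite -RintegralB//; last exact: (integrableD (mu := mu) mD (iZ 2 l) (iZ 2 r)).
apply: eq_Rintegral => t _.
by rewrite /A /B /= !(parallelogram norm_dot); ring.
Qed.

(* the least energy of an average of terms of index at least [n], and its limit *)
Let I n := inf [set energy tr | tr in [set tr | leaves_ge n tr]].
Let J := sup (range I).

Let I_has n : has_inf [set energy tr | tr in [set tr | leaves_ge n tr]].
Proof.
split; first by exists (energy (leaf n)), (leaf n) => //=.
by exists 0 => _ [tr _ <-]; exact: energy_ge0.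
Qed.

Let I_le n tr : leaves_ge n tr -> I n <= energy tr.
Proof. by move=> h; apply: ge_inf; [exact: (I_has n).2|exists tr]. Qed.

Let I_nd m n : (m <= n)%N -> I m <= I n.
Proof.
move=> mn; apply: lb_le_inf; first exact: (I_has n).1.
by move=> _ [tr /= /(leaves_geW mn) h <-]; exact: I_le.
Qed.

Let J_has : has_sup (range I).
Proof.
split; first by exists (I 0%N), 0%N.
exists C => _ [n _ <-]; apply: le_trans (I_le _) (energy_le (leaf n)); exact: leqnn.
Qed.

Let I_J n : I n <= J.
Proof. by apply: ub_le_sup; [exact: J_has.2|exists n]. Qed.

Let almost_minimal (j : nat) (e : R) : 0 < e ->
  exists ntr : nat * tree, [/\ (j <= ntr.1)%N, leaves_ge ntr.1 ntr.2,
    J - e <= I ntr.1 & energy ntr.2 <= J + e].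
Proof.
move=> e0; have [_ [n0 _ <-] n0J] := sup_adherent e0 J_has.
pose n := maxn j n0.
have [_ [tr trn <-] trI] := inf_adherent e0 (I_has n).
exists (n, tr); split=> //=; first exact: leq_maxl.
  by rewrite (le_trans (ltW n0J))// I_nd// leq_maxr.
by rewrite (le_trans (ltW trI))// lerD2r I_J.
Qed.

(** Mazur's lemma without weak limits.  Let [tau j] average terms of index at least
    [j] with energy within [e j] of the limit [J] of the least energies.  The
    midpoint of [tau j] and [tau j.+1] has energy at least [J - e j], so by the
    parallelogram identity the two averages are close in mean square.  With [e j]
    decreasing fast enough the squared steps, weighted by [4 ^+ j], have finite sum
    almost everywhere, which makes the steps geometrically small. *)
Lemma mix_cvg_ae : exists2 tau : nat -> tree, (forall j, leaves_ge j (tau j)) &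
  {ae mu, forall t, D t -> cvgn (fun j => A (tau j) t) /\ cvgn (fun j => B (tau j) t)}.
Proof.
(* the [j]-th weighted squared step has integral at most [8 * 4 ^+ j * e j] *)
pose e j : R := (8 * 4 ^+ j * 2 ^+ j.+1)^-1.
have e0 j : 0 < e j by rewrite invr_gt0 !mulr_gt0// exprn_gt0.
have e_dec j : e j.+1 <= e j.
  have -> : e j.+1 = e j / 8.
    by rewrite /e !exprS; field; rewrite !expf_neq0.
  by have := e0 j; lra.
pose s j := sval (cid (almost_minimal j (e0 j))).
have sP j : [/\ (j <= (s j).1)%N, leaves_ge (s j).1 (s j).2,
    J - e j <= I (s j).1 & energy (s j).2 <= J + e j].
  by rewrite /s; case: cid.
pose tau j := (s j).2.
exists tau; first by move=> j; have [js ls _ _] := sP j; exact: leaves_geW js ls.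
pose F j t := 4 ^+ j * (`|A (tau j) t - A (tau j.+1) t| ^+ 2 +
                        `|B (tau j) t - B (tau j.+1) t| ^+ 2).
have F0 j t : 0 <= F j t.
  by rewrite mulr_ge0 ?exprn_ge0// addr_ge0// sqr_ge0.
have normB2 (u w : H) : `|u| <= M -> `|w| <= M -> `|u - w| <= M + M.
  by move=> uM wM; rewrite (le_trans (ler_normB _ _))// lerD.
have iG j : mu.-integrable D (EFin \o (fun t => `|A (tau j) t - A (tau j.+1) t| ^+ 2 +
                        `|B (tau j) t - B (tau j.+1) t| ^+ 2)).
  have i2 (U V : R -> H) : separably_measurable U -> separably_measurable V ->
      (forall t, `|U t| <= M) -> (forall t, `|V t| <= M) ->
      mu.-integrable D (EFin \o (fun t => `|U t - V t| ^+ 2)).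
    move=> mU mV UM VM.
    exact: (@integrable_sqr (fun t => U t - V t) (M + M) (sm_sub mU mV)
      (fun t => normB2 _ _ (UM t) (VM t))).
  exact: (integrableD (mu := mu) mD 
    (i2 (A (tau j)) (A (tau j.+1)) (mA _) (mA _) (AM _) (AM _))
    (i2 (B (tau j)) (B (tau j.+1)) (mB _) (mB _) (BM _) (BM _))).
have iF j : mu.-integrable D (EFin \o F j) by exact: (integrableZl (mu := mu) mD _ (iG j)).
have mF j : measurable_fun D (fun t => (F j t)%:E) by exact: (measurable_int mu (iF j)).
have small j : \int[mu]_(t in D) F j t <= 1 / (2 ^ j.+1)%:R.
  rewrite RintegralZl// energy_parallelogram.
  have [_ l1 J1 E1] := sP j; have [_ l2 J2 E2] := sP j.+1.
  have : J - e j <= energy (node (tau j) (tau j.+1)).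
    have [le12|/ltnW le21] := leqP (s j).1 (s j.+1).1.
      by rewrite (le_trans J1)// I_le//= l1 (leaves_geW le12 l2).
    rewrite (@le_trans _ _ (J - e j.+1))//; first by rewrite lerD2l lerN2.
    by rewrite (le_trans J2)// I_le//= l2 (leaves_geW le21 l1).
  have := e_dec j; rewrite -/(tau j) -/(tau j.+1) in E1 E2 * => ed lowE.
  apply: (@le_trans _ _ (4 ^+ j * (8 * e j))).
    by rewrite ler_wpM2l ?exprn_ge0//; lra.
  have -> : 4 ^+ j * (8 * e j) = (2 ^+ j.+1)^-1.
    by rewrite /e; field; rewrite !expf_neq0.
  by rewrite natrX div1r.
have F0E j t : (0 <= (F j t)%:E)%E by rewrite lee_fin.
have int_fin : mu.-integrable D (fun t => \sum_(j <oo) (F j t)%:E)%E.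
  apply/integrableP; split.
    exact: (ge0_emeasurable_sum (P := xpredT) (fun k x _ _ => F0E k x) (fun k _ => mF k)).
  have -> : (\int[mu]_(t in D) `|\sum_(j <oo) (F j t)%:E| =
             \sum_(j <oo) \int[mu]_(t in D) (F j t)%:E)%E.
    rewrite -(integral_nneseries mu mD mF (fun j t _ => F0E j t)).
    apply: eq_integral => t _; rewrite gee0_abs//.
    by apply: nneseries_ge0 => j _ _; rewrite lee_fin.
  apply: le_lt_trans (ltry 1).
  apply: le_trans (epsilon_trick0 xpredT ler01).
  apply: lee_nneseries => [j _ _|j _].
    by apply: integral_ge0 => t _; rewrite lee_fin.
  rewrite -[leLHS]fineK; first by rewrite lee_fin; exact: small.
  exact: (integrable_fin_num _ (iF j)).
apply: ae_impl (integrable_ae _ int_fin) => // t fin_t Dt.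
have {fin_t}fin_t := fin_t Dt.
pose K := fine (\sum_(j <oo) (F j t)%:E)%E.
have FK j : F j t <= K.
  rewrite -lee_fin fineK//.
  apply: le_trans (nneseries_lim_ge j.+1 _); last by move=> k _ _; rewrite lee_fin.
  rewrite sumEFin lee_fin big_nat_recr//= lerDr.
  by apply: sumr_ge0.
have K0 : 0 <= K by exact: le_trans (FK 0%N).
have step (x q : R) j : 0 <= x -> 0 <= q -> 4 ^+ j * (x ^+ 2 + q) <= K ->
    x <= Num.sqrt K * (2 ^+ j)^-1.
  move=> x0 q0 h; rewrite -(@ler_pXn2r _ 2)// ?nnegrE ?mulr_ge0 ?sqrtr_ge0 ?invr_ge0 ?exprn_ge0//.
  rewrite exprMn sqr_sqrtr// exprVn -exprM mulnC exprM.
  rewrite ler_pdivlMr ?exprn_gt0 ?mulr_gt0//.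
  rewrite (_ : 2 ^+ 2 = 4 :> R); last by ring.
  by rewrite mulrC (le_trans _ h)// ler_wpM2l ?exprn_ge0// lerDl.
split.
  apply: (@halving_steps_cvg _ _ (Num.sqrt K)) => j.
  by apply: step (FK j) => //; exact: sqr_ge0.
apply: (@halving_steps_cvg _ _ (Num.sqrt K)) => j.
apply: (@step _ (`|A (tau j) t - A (tau j.+1) t| ^+ 2)) => //.
by rewrite addrC; exact: FK.
Qed.

Lemma mazur_ae : exists (tau : nat -> tree) (va vb : R -> H),
  [/\ forall j, leaves_ge j (tau j),
      separably_measurable va /\ (forall t, `|va t| <= M),
      separably_measurable vb /\ (forall t, `|vb t| <= M) &
      {ae mu, forall t, D t -> A (tau j) t @[j --> \oo] --> va t /\
                               B (tau j) t @[j --> \oo] --> vb t}].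
Proof.
have [tau tauP [N [mN N0 NP]]] := mix_cvg_ae.
pose G := D `\` N.
have mG : measurable G by exact: measurableD.
have M0 : 0 <= M by rewrite (le_trans _ (aM 0%N 0)).
have good t : G t -> cvgn (fun j => A (tau j) t) /\ cvgn (fun j => B (tau j) t).
  by move=> [Dt Nt]; apply: contrapT => h; apply: Nt; apply: NP => /(_ Dt).
have build (U : tree -> R -> H) : (forall tr, separably_measurable (U tr)) ->
    (forall tr t, `|U tr t| <= M) -> (forall t, G t -> cvgn (fun j => U (tau j) t)) ->
    let w t := (\1_G t : R) *: limn (fun j => U (tau j) t) in
    separably_measurable w /\ (forall t, `|w t| <= M).
  move=> mU UM Ucv w.
  have wl t : (\1_G t : R) *: U (tau j) t @[j --> \oo] --> w t.
    rewrite /w indicE; have [/set_mem Gt|_] := boolP (t \in G).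
      by rewrite scale1r; under eq_fun do rewrite scale1r; exact: Ucv.
    by rewrite scale0r; under eq_fun do rewrite scale0r; exact: cvg_cst.
  split; first by apply: sm_lim wl => j; exact: sm_indic.
  move=> t.
  have cl : `|(\1_G t : R) *: U (tau j) t| @[j --> \oo] --> `|w t| by exact: cvg_norm (wl t).
  have cr : (fun=> M : R) @ \oo --> M by exact: cvg_cst.
  apply: (ler_cvg_to cl cr); apply: nearW => j.
  rewrite indicE; case: (t \in G); first by rewrite scale1r.
  by rewrite scale0r normr0.
exists tau, (fun t => (\1_G t : R) *: limn (fun j => A (tau j) t)),
  (fun t => (\1_G t : R) *: limn (fun j => B (tau j) t)); split=> //.
- by apply: build => // t /good[].
- by apply: build => // t /good[].
exists N; split=> // t /= /not_implyP[Dt]; apply: contra_notP => Nt.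
have Gt : G t by [].
by rewrite indicE mem_set// !scale1r; exact: good.
Qed.

End Energy.

End Mazur.

(** * Distances, approximate projections and time grids *)

Section Distances.
Context {R : realType} {H : normedModType R}.
Implicit Types (S A B : set H) (x y z : H).

Lemma dist_ge0 S x : (0 <= dist S x)%E.
Proof. by apply: le_ereal_inf_tmp => _ [z _ <-]; rewrite lee_fin. Qed.

Lemma dist_le S x z : S z -> (dist S x <= `|x - z|%:E)%E.
Proof. by move=> Sz; apply: ereal_inf_lbound; exists z. Qed.

Lemma dist_lt_ex S x (r e : R) : (dist S x <= r%:E)%E -> 0 < e ->
  exists2 z, S z & `|x - z| <= r + e.
Proof.
move=> Sr e0.
have : (dist S x < (r + e)%:E)%E by apply: (le_lt_trans Sr); rewrite lte_fin ltrDl.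
by move=> /ereal_inf_lt[_ [z Sz <-]]; rewrite lte_fin => /ltW; exists z.
Qed.

Lemma Haus_near A B (r e : R) z : (Haus A B <= r%:E)%E -> A z -> 0 < e ->
  exists2 z', B z' & `|z - z'| <= r + e.
Proof.
move=> ABr Az; apply: dist_lt_ex; apply: le_trans ABr.
rewrite /Haus le_max; apply/orP; left.
by apply: ereal_sup_ubound; exists z.
Qed.

Lemma dist_sqr_le S x z (c e : R) : S z ->
  (c%:E < dist S x ^+ 2 + e%:E)%E -> c < `|x - z| ^+ 2 + e.
Proof.
move=> Sz h; rewrite -lte_fin; apply: (lt_le_trans h).
rewrite EFinD leeD2r// expe2 expr2 EFinM.
by apply: lee_pmul; rewrite ?dist_ge0 ?dist_le.
Qed.

Lemma approx_proj_outerP (e eta : R) S y z : approx_proj_outer e eta S y z ->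
  (exists2 z', S z' & `|z - z'| <= eta) /\
  (forall w, S w -> `|y - z| ^+ 2 <= `|y - w| ^+ 2 + e).
Proof.
move=> [Se [_ _ Ssub Sez ez]]; split.
  have [a Sa [b beta <-]] := Ssub _ Sez.
  by exists a => //; rewrite addrC addKr.
by move=> w Sw; apply/ltW/(dist_sqr_le Sw).
Qed.

(** [r ^+ 2 + g <= (r + 1 + g) ^+ 2]. *)
Lemma approx_proj_bound (g r : R) S z : 0 <= g -> 0 <= r -> (dist S 0%R <= r%:E)%E ->
  approx_proj g S 0 z -> `|z| <= r + 1 + g.
Proof.
move=> g0 r0 Sr [Sz]; rewrite sub0r normrN => h.
have : ((`|z| ^+ 2)%:E < (r ^+ 2 + g)%:E)%E.
  apply: (lt_le_trans h); rewrite EFinD leeD2r// expe2 expr2 EFinM.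
  by apply: lee_pmul; rewrite ?dist_ge0.
rewrite lte_fin => h2; rewrite -(@ler_pXn2r _ 2)// ?nnegrE ?addr_ge0//; nra.
Qed.

End Distances.

Section Nodes.
Context {R : realType} (T : R) (n : nat).
Hypotheses (T0 : 0 < T) (n0 : (0 < n)%N).
Let mu := T / n%:R.

Lemma step_gt0 : 0 < mu. Proof. by rewrite divr_gt0// ltr0n. Qed.

Lemma tnode0 : tnode T n 0 = 0. Proof. by rewrite /tnode !mul0r. Qed.

Lemma tnodeS k : tnode T n k.+1 = tnode T n k + mu.
Proof. by rewrite /tnode -natr1 !mulrDl mul1r. Qed.

Lemma tnode_last : tnode T n n = T.
Proof. by rewrite /tnode mulrAC divff ?mul1r// pnatr_eq0 -lt0n. Qed.

Lemma tnode_le k l : (k <= l)%N -> tnode T n k <= tnode T n l.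
Proof.
move=> kl; rewrite /tnode -!mulrA ler_wpM2r ?ler_nat//.
exact/ltW/step_gt0.
Qed.

Lemma tnode_itv k : (k <= n)%N -> `[0, T]%classic (tnode T n k).
Proof.
move=> kn; rewrite /= in_itv/=; apply/andP; split.
  by rewrite -[leLHS]tnode0 tnode_le.
by rewrite -[leRHS]tnode_last tnode_le.
Qed.

Lemma tnode_locate t : 0 < t -> t <= T ->
  exists2 k, (k < n)%N & tnode T n k < t <= tnode T n k.+1.
Proof.
move=> t0 tT.
have ex : exists k, t <= tnode T n k by exists n; rewrite tnode_last.
case: (ex_minnP ex) => [[|k]]; first by rewrite tnode0 leNgt t0.
move=> tk kmin; exists k; first by apply: kmin; rewrite tnode_last.
by rewrite tk andbT ltNge; apply/negP => /kmin; rewrite ltnn.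
Qed.

Lemma tnode_unique t k l : tnode T n k < t <= tnode T n k.+1 ->
  tnode T n l < t <= tnode T n l.+1 -> k = l.
Proof.
move=> /andP[kt tk] /andP[lt tl]; apply/eqP; rewrite eqn_leq; apply/andP; split.
  rewrite leqNgt; apply/negP => /tnode_le lk.
  by have := lt_le_trans (lt_le_trans kt tl) lk; rewrite ltxx.
rewrite leqNgt; apply/negP => /tnode_le kl.
by have := lt_le_trans (lt_le_trans lt tk) kl; rewrite ltxx.
Qed.

Definition piecewise {V : lmodType R} (U : nat -> R -> V) (t : R) : V :=
  \sum_(k < n) (\1_(`]tnode T n k, tnode T n k.+1]%classic) t : R) *: U k t.

Lemma piecewiseE {V : lmodType R} (U : nat -> R -> V) k t : (k < n)%N ->
  tnode T n k < t <= tnode T n k.+1 -> piecewise U t = U k t.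
Proof.
move=> kn tk; rewrite /piecewise (bigD1 (Ordinal kn))//= big1 ?addr0.
  by rewrite indicE mem_set ?scale1r//= in_itv.
move=> i ik; rewrite indicE memNset ?scale0r//= in_itv/= => ti.
by move/eqP: ik; apply; apply/val_inj => /=; exact: tnode_unique ti tk.
Qed.

Lemma piecewise_bounded {V : normedModType R} (U : nat -> R -> V) (M : R) t :
  0 <= M -> (forall k t, (k < n)%N -> `|U k t| <= M) -> `|piecewise U t| <= M.
Proof.
move=> M0 UM.
have [[k kn tk]|no] := pselect (exists2 k, (k < n)%N & tnode T n k < t <= tnode T n k.+1).
  by rewrite (piecewiseE _ kn tk) UM.
rewrite /piecewise big1 ?normr0// => i _.
rewrite indicE memNset ?scale0r//= in_itv/= => ti.
by apply: no; exists i.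
Qed.

Lemma sm_piecewise {V : normedModType R} (U : nat -> R -> V) :
  (forall k, separably_measurable (U k)) -> separably_measurable (piecewise U).
Proof.
move=> mU; apply: sm_sum => k; apply: sm_indic => //; exact: measurable_itv.
Qed.

End Nodes.

(** * The inexact catching-up algorithm *)

(** The discrete Gronwall inequality. *)
Lemma gronwall {R : realType} (a b T : R) (n : nat) (r : nat -> R) :
  0 < a -> 0 <= b -> 0 < T -> (0 < n)%N -> r 0%N = 0 ->
  (forall k, (k < n)%N -> r k.+1 <= r k + T / n%:R * (a * r k + b)) ->
  forall k, (k <= n)%N -> r k <= expR (a * T) * b / a.
Proof.
move=> a0 b0 T0 n0 r0 rS.
have mu0 : 0 < T / n%:R by rewrite divr_gt0// ltr0n.
set m := T / n%:R in rS mu0 *.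
have pow k : (k <= n)%N -> r k <= (1 + a * m) ^+ k * (b / a).
  have ba : 0 <= b / a by rewrite divr_ge0// ltW.
  suff h : (k <= n)%N -> r k + b / a <= (1 + a * m) ^+ k * (b / a).
    by move=> /h; apply: le_trans; rewrite lerDl.
  elim: k => [_|k IH kn]; first by rewrite r0 add0r expr0 mul1r.
  have {}IH := IH (ltnW kn).
  apply: (@le_trans _ _ ((1 + a * m) * (r k + b / a))); last first.
    by rewrite exprS -mulrA ler_pM2l// addr_gt0// mulr_gt0.
  rewrite (_ : (1 + a * m) * (r k + b / a) = r k + m * (a * r k + b) + b / a); last first.
    by field; rewrite gt_eqF.
  by rewrite lerD2r rS.
move=> k kn; apply: le_trans (pow _ kn) _; rewrite -mulrA.
rewrite ler_wpM2r ?divr_ge0 ?(ltW a0)//.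
apply: (@le_trans _ _ (expR (a * m) ^+ k)).
  by rewrite lerXn2r ?nnegrE ?expR_ge0 ?expR_ge1Dx// addr_ge0// mulr_ge0// ltW.
rewrite -expRM_natl ler_expR mulrCA ler_pM2l// /m.
by rewrite mulrCA ler_piMr ?(ltW T0)// ler_pdivrMr ?ltr0n// mul1r ler_nat.
Qed.

Section Scheme.
Context {R : realType} {H : completeNormedModType R} (dot : {dot H for idfun}).
Hypothesis norm_dot : forall x : H, dot x x = `|x| ^+ 2.
Local Notation mu := (@lebesgue_measure R).
Variables (T : R) (C : R -> set H) (LC : R) (x0 : H) (F : R -> H -> set H).
Variables (h : H -> R) (Lh gamma : R) (f : R -> H -> H).
Hypotheses (T_gt0 : 0 < T) (LC_ge0 : 0 <= LC).
Hypothesis C_lip : forall t s : R, `[0, T]%classic t -> `[0, T]%classic s ->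
  (Haus (C t) (C s) <= (LC * `|t - s|)%:E)%E.
Hypothesis C_ball_compact : forall t : R, `[0, T]%classic t -> ball_compact (C t).
Hypothesis x0C : C 0 x0.
Hypotheses (h_ge0 : forall x, 0 <= h x) (Lh_gt0 : 0 < Lh) (h_lip : Lh.-lipschitz h).
Hypothesis F_bound : forall x : H, {ae mu, forall t : R,
    `[0, T]%classic t -> (dist (F t x) 0%R <= (h x)%:E)%E}.
Hypothesis gamma_gt0 : 0 < gamma.
Hypothesis f_proj : forall (t : R) (x : H), `[0, T]%classic t ->
  approx_proj gamma (F t x) 0 (f t x).
Hypothesis f_meas : forall x, strongly_measurable `[0, T] (f ^~ x).

(** Bounds [f t y] for almost every [t], see [approx_proj_bound]. *)
Definition growth (y : H) : R := h y + 1 + gamma.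

Lemma growth_gt0 y : 0 < growth y.
Proof. by rewrite /growth addr_gt0// ltr_wpDl. Qed.

Lemma growth_le y z : growth y <= growth z + Lh * `|y - z|.
Proof.
have := h_lip (conj Logic.I Logic.I : (setT `*` setT) (y, z)).
by move=> /= /(le_trans (ler_norm _)); rewrite /growth; lra.
Qed.

Lemma C_near t s z e : `[0, T]%classic t -> `[0, T]%classic s -> C t z -> 0 < e ->
  exists2 z', C s z' & `|z - z'| <= LC * `|t - s| + e.
Proof. by move=> It Is Ctz e0; apply: Haus_near (C_lip It Is) Ctz e0. Qed.

(** The bound on the field holds only off a null set, hence the passage to a
    version that is measurable and bounded everywhere. *)
Lemma field_version y : exists g, [/\ separably_measurable g,
  forall t, `|g t| <= growth y & {ae mu, forall t, `[0, T]%classic t -> g t = f t y}].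
Proof.
have fb : {ae mu, forall t, `[0, T]%classic t -> `|f t y| <= growth y}.
  apply: ae_impl (F_bound y) => t Fb It.
  by apply: approx_proj_bound (Fb It) (f_proj y It) => //; exact: ltW.
have [g [mg gP gf]] := strongly_measurable_sm (measurable_itv _) (f_meas y) fb.
exists g; split=> // t.
by case: (gP t) => [[->]//|->]; rewrite normr0 ltW// growth_gt0.
Qed.

Lemma bochner_field y g s t : separably_measurable g -> (forall t, `|g t| <= growth y) ->
  {ae mu, forall t, `[0, T]%classic t -> g t = f t y} -> 0 <= s -> t <= T ->
  forall p, dot (bochner_integral s t (f ^~ y)) p =
            \int[mu]_(r in `[s, t]) (dot (g r) p : R).
Proof.
move=> mg gM gf s0 tT.
have sub : `[s, t]%classic `<=` `[0, T]%classic.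
  by move=> r /=; rewrite !in_itv/= => /andP[sr rt]; rewrite (le_trans s0 sr) (le_trans rt tT).
apply: (bochner_integral_dot norm_dot _ mg gM).
  exact: strongly_measurableS sub (f_meas y).
by apply: ae_impl gf => r gr /sub.
Qed.

(** All scalar products of this vector are integrals over a single point. *)
Lemma bochner_field_diag y s : 0 <= s -> s <= T -> bochner_integral s s (f ^~ y) = 0.
Proof.
move=> s0 sT; have [g [mg gM gf]] := field_version y.
apply/eqP; rewrite -normr_eq0 -sqrf_eq0 -norm_dot (bochner_field mg gM gf s0 sT).
by rewrite set_itv1 Rintegral_set1.
Qed.

Lemma bochner_field_le y s t : 0 <= s -> s <= t -> t <= T ->
  `|bochner_integral s t (f ^~ y)| <= growth y * (t - s).
Proof.
move=> s0 st tT; have [g [mg gM gf]] := field_version y.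
have sT := le_trans st tT.
pose G r := bochner_integral s r (f ^~ y).
have Gs : G s = 0 by exact: bochner_field_diag.
have := @increment_lip _ _ _ norm_dot _ _ mg gM G s t st.
rewrite Gs subr0; apply=> p; rewrite Gs subr0.
exact: (bochner_field mg gM gf s0 tT).
Qed.

(* [A] bounds the tolerances of all steps, measured in units of the step length *)
Variable A : R.
Hypothesis A_ge0 : 0 <= A.

(** Constants that do not depend on the number of steps: [slack] bounds the part of
    a projection displacement, per unit of time, that does not come from the field;
    [radius] bounds the distance of the nodes to [x0] (by Gronwall's inequality);
    [speed] and [push] bound the field along the nodes and the displacements due to
    the projections, per unit of time. *)
Definition slack : R := LC + 1 + 2 * A.
Definition radius : R := expR (2 * Lh * T) * (2 * growth x0 + slack) / (2 * Lh).
Definition speed : R := growth x0 + Lh * radius.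
Definition push : R := speed + slack.
Definition Kerr : R := push + push + LC + 1 +
  (T + 1) * (2 * Num.sqrt (2 * A + 2 * push) + 1).
(** Common bound for every discrepancy between the scheme with step length [m] and
    tolerance [theta] and the differential inclusion.  The square root comes from
    [approx_projection_normal]. *)
Definition err (m theta : R) : R := Kerr * (m + theta + Num.sqrt theta).

Lemma slack_gt0 : 0 < slack.
Proof. by rewrite /slack; have := LC_ge0; have := A_ge0; lra. Qed.

Lemma radius_ge0 : 0 <= radius.
Proof.
rewrite /radius divr_ge0 ?mulr_ge0 ?expR_ge0 ?(ltW Lh_gt0)//.
by have := slack_gt0; have := growth_gt0 x0; lra.
Qed.

Lemma speed_gt0 : 0 < speed.
Proof. by rewrite /speed ltr_wpDr ?growth_gt0// mulr_ge0 ?radius_ge0// ltW. Qed.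

Lemma push_gt0 : 0 < push.
Proof. by rewrite /push addr_gt0 ?speed_gt0 ?slack_gt0. Qed.

Lemma Kerr_ge0 : 0 <= Kerr.
Proof.
have p := push_gt0; rewrite /Kerr addr_ge0//.
  by have := LC_ge0; lra.
by rewrite mulr_ge0 ?addr_ge0 ?mulr_ge0 ?sqrtr_ge0// ltW.
Qed.

Section FixedStep.
Variables (n : nat) (eps eta theta : R) (xs : nat -> H).
Hypotheses (n0 : (0 < n)%N) (eta0 : 0 <= eta).
Local Notation m := (T / n%:R).
Local Notation node := (tnode T n).
Hypotheses (theta0 : 0 <= theta) (thetaA : theta <= A).
Hypotheses (eta_le : eta <= theta * m) (eps_le : eps <= (theta * m) ^+ 2).
Hypothesis xs0 : xs 0%N = x0.
Local Notation y k := (xs k + bochner_integral (node k) (node k.+1) (f ^~ (xs k))).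
Hypothesis xsP : forall k, (k < n)%N ->
  approx_proj_outer eps eta (C (node k.+1)) (y k) (xs k.+1).

Let m0 : 0 < m. Proof. exact: step_gt0. Qed.

Let node_ge0 k : 0 <= node k.
Proof. by rewrite -[leLHS](tnode0 T n) tnode_le. Qed.

Let node_le k : (k <= n)%N -> node k <= T.
Proof. by move=> kn; rewrite -[leRHS](tnode_last T n0) tnode_le. Qed.

Let node_diff k : node k.+1 - node k = m.
Proof. by rewrite tnodeS addrC addKr. Qed.

Let node_leS k : node k <= node k.+1.
Proof. by rewrite tnode_le. Qed.

Lemma node_near k : (k <= n)%N -> exists2 z, C (node k) z & `|xs k - z| <= eta.
Proof.
case: k => [_|k kn]; first by exists x0; rewrite ?tnode0// xs0 subrr normr0.
by have [] := approx_proj_outerP (xsP kn).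
Qed.

Lemma step_integral_le k : (k < n)%N ->
  `|bochner_integral (node k) (node k.+1) (f ^~ (xs k))| <= growth (xs k) * m.
Proof. by move=> kn; rewrite -(node_diff k); exact: bochner_field_le (node_le _). Qed.

(** The node [xs k] is close to a point of [C (node k)], hence to one of
    [C (node k.+1)], and the projection step does not do much worse than that
    point. *)
Lemma step_dist k : (k < n)%N -> `|y k - xs k.+1| <= m * (growth (xs k) + slack).
Proof.
move=> kn; have [z Cz xz] := node_near (ltnW kn).
have Ik := tnode_itv T_gt0 n0 (ltnW kn); have Ik1 := tnode_itv T_gt0 n0 kn.
have [z' Cz' zz'] := C_near Ik Ik1 Cz m0.
rewrite (distrC (node k)) node_diff (gtr0_norm m0) in zz'.
have [_ /(_ _ Cz') ymin] := approx_proj_outerP (xsP kn).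
set I := bochner_integral _ _ _ in ymin *.
have Ile : `|I| <= growth (xs k) * m by exact: step_integral_le.
pose D := growth (xs k) * m + theta * m + (LC * m + m).
have yz : `|xs k + I - z'| <= D.
  rewrite (_ : _ - z' = I + (xs k - z) + (z - z')); last first.
    by rewrite -[RHS]addrA subrKA addrCA addrA.
  rewrite /D; have := ler_normD (I + (xs k - z)) (z - z').
  have := ler_normD I (xs k - z); move: Ile xz zz' eta_le; lra.
have tm : 0 <= theta * m by rewrite mulr_ge0// ltW.
have D0 : 0 <= D by exact: le_trans (normr_ge0 _) yz.
have : `|xs k + I - xs k.+1| <= D + theta * m.
  rewrite -(@ler_pXn2r _ 2) ?nnegrE ?normr_ge0//; last exact: addr_ge0 D0 tm.
  have : `|xs k + I - z'| ^+ 2 <= D ^+ 2 by rewrite lerXn2r ?nnegrE.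
  by move: ymin eps_le tm D0; nra.
move=> /le_trans; apply; rewrite /D /slack.
have : theta * m <= A * m by rewrite ler_pM2r.
lra.
Qed.

Lemma node_move k : (k < n)%N -> `|xs k.+1 - xs k| <= m * (2 * growth (xs k) + slack).
Proof.
move=> kn; have := step_dist kn; have := step_integral_le kn.
set I := bochner_integral _ _ _ => Ile yle.
rewrite (_ : xs k.+1 - xs k = I - (xs k + I - xs k.+1)); last first.
  by rewrite opprB addrCA [xs k + _]addrC opprD addNKr.
by have := ler_normB I (xs k + I - xs k.+1); lra.
Qed.

Lemma node_radius k : (k <= n)%N -> `|xs k - x0| <= radius.
Proof.
apply: (@gronwall _ _ _ _ n (fun k => `|xs k - x0|)) => //.
- by rewrite mulr_gt0.
- by have := slack_gt0; have := growth_gt0 x0; lra.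
- by rewrite xs0 subrr normr0.
move=> j jn; rewrite -(subrKA (xs j)) (le_trans (ler_normD _ _))// addrC lerD2l.
rewrite (le_trans (node_move jn))// ler_pM2l//.
by have := growth_le (xs j) x0; lra.
Qed.

Lemma growth_node k : (k <= n)%N -> growth (xs k) <= speed.
Proof.
move=> kn; rewrite (le_trans (growth_le _ x0))// lerD2l ler_pM2l//.
exact: node_radius.
Qed.

Lemma step_push k : (k < n)%N -> `|y k - xs k.+1| <= m * push.
Proof.
move=> kn; rewrite (le_trans (step_dist kn))// ler_pM2l// lerD2r.
exact: growth_node (ltnW kn).
Qed.


Variable x : R -> H.
Hypothesis x_0 : x 0 = x0.
Hypothesis xE : forall k t, (k < n)%N -> node k < t <= node k.+1 ->
  x t = xs k + ((t - node k) / m) *: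
      (xs k.+1 - xs k - bochner_integral (node k) (node k.+1) (f ^~ (xs k)))
    + bochner_integral (node k) t (f ^~ (xs k)).

Let beta k : H := m^-1 *: (y k - xs k.+1).
Let g k : R -> H := sval (cid (field_version (xs k))).

Let gP k : [/\ separably_measurable (g k), forall t, `|g k t| <= growth (xs k) &
  {ae mu, forall t, `[0, T]%classic t -> g k t = f t (xs k)}].
Proof. by rewrite /g; case: cid. Qed.

(** The derivative of the interpolation is [drift - thrust]: the field frozen at the
    last node, and the average velocity with which the projection pushes back. *)
Definition drift : R -> H := piecewise T n g.
Definition thrust : R -> H := piecewise T n (fun k _ => beta k).

Let beta_le k : (k < n)%N -> `|beta k| <= push.
Proof. by move=> kn; rewrite normrZ gtr0_norm ?invr_gt0// ler_pdivrMl// step_push. Qed.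

Lemma drift_sm : separably_measurable drift.
Proof. by apply: sm_piecewise => k; have [] := gP k. Qed.

Lemma thrust_sm : separably_measurable thrust.
Proof. by apply: sm_piecewise => k; exact: sm_cst. Qed.

Lemma thrust_le t : `|thrust t| <= push.
Proof.
by apply: piecewise_bounded => //; [exact: ltW push_gt0|move=> k _; exact: beta_le].
Qed.

Lemma drift_le t : `|drift t| <= push.
Proof.
apply: piecewise_bounded => //; first exact: ltW push_gt0.
move=> k s kn; have [_ gM _] := gP k; rewrite (le_trans (gM s))//.
rewrite (le_trans (growth_node (ltnW kn)))// /push lerDl.
exact: ltW slack_gt0.
Qed.

Let xE' k t : (k < n)%N -> node k < t <= node k.+1 ->
  x t = xs k - (t - node k) *: beta k + bochner_integral (node k) t (f ^~ (xs k)).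
Proof.
move=> kn tk; rewrite (xE kn tk) /beta; congr (_ + _ + _).
rewrite scalerA -[RHS]scalerN; congr (_ *: _).
by rewrite opprB opprD addrA.
Qed.

Lemma x_node k : (k <= n)%N -> x (node k) = xs k.
Proof.
case: k => [_|k kn]; first by rewrite tnode0 x_0 xs0.
rewrite (xE kn) ?node_diff; last by rewrite lexx andbT -subr_gt0 node_diff.
rewrite divff ?gt_eqF// scale1r -addrA subrK.
by rewrite addrC subrK.
Qed.

Let step_value k t : (k < n)%N -> node k <= t <= node k.+1 ->
  x t = xs k - (t - node k) *: beta k + bochner_integral (node k) t (f ^~ (xs k)).
Proof.
move=> kn /andP[kt tk]; have [ntk|] := ltP (node k) t.
  by apply: xE' => //; rewrite ntk.
move=> tk'; have -> : t = node k by apply/eqP; rewrite eq_le tk' kt.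
rewrite subrr scale0r subr0 (x_node (ltnW kn)) bochner_field_diag ?addr0//.
exact: node_le (ltnW kn).
Qed.

Let increment_step k t : (k < n)%N -> node k <= t <= node k.+1 ->
  increment dot x (fun r => drift r - thrust r) (node k) t.
Proof.
move=> kn tk p; have [mg gM gf] := gP k; have /andP[kt tk1] := tk.
have tT : t <= T by rewrite (le_trans tk1)// node_le.
rewrite (x_node (ltnW kn)) (step_value kn tk).
rewrite addrAC [xs k - _]addrC addrK addrC dotBl dotZl.
rewrite (bochner_field mg gM gf (node_ge0 k) tT).
have sm_u : separably_measurable (fun r => drift r - thrust r).
  by apply: sm_sub; [exact: drift_sm|exact: thrust_sm].
have uM r : `|drift r - thrust r| <= push + push.
  by rewrite (le_trans (ler_normB _ _))// lerD ?drift_le ?thrust_le.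
have sm_w : separably_measurable (fun r => g k r - beta k).
  by apply: sm_sub => //; exact: sm_cst.
have wM r : `|g k r - beta k| <= growth (xs k) + `|beta k|.
  by rewrite (le_trans (ler_normB _ _))// lerD.
have sub : `]node k, t]%classic `<=` `[node k, t]%classic.
  by move=> r /=; rewrite !in_itv/= => /andP[/ltW -> ->].
have iu := dot_integrable norm_dot p (measurable_itv `[node k, t]) (itv_cc_lty _ _) sm_u uM.
have iw := dot_integrable norm_dot p (measurable_itv `[node k, t]) (itv_cc_lty _ _) sm_w wM.
rewrite -(Rintegral_itv_obnd_cbnd (f := fun r => dot (drift r - thrust r) p)); last first.
  exact: integrableS iu.
transitivity (\int[mu]_(r in `]node k, t]) (dot (g k r - beta k) p : R)); last first.
  apply: eq_Rintegral => r /set_mem/=; rewrite in_itv/= => /andP[kr rt].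
  have rk : node k < r <= node k.+1 by rewrite kr (le_trans rt).
  by rewrite /drift /thrust !(piecewiseE T_gt0 n0 _ kn rk).
rewrite (Rintegral_itv_obnd_cbnd (f := fun r => dot (g k r - beta k) p)); last first.
  exact: integrableS iw.
under [RHS]eq_Rintegral do rewrite dotBl.
rewrite RintegralB//; last 2 first.
- exact: (dot_integrable norm_dot p (measurable_itv `[node k, t]) (itv_cc_lty _ _) mg gM).
- apply: (@dot_integrable _ _ _ norm_dot _ (cst (beta k)) p `|beta k|) => //.
    exact: itv_cc_lty.
  exact: sm_cst.
congr (_ - _).
rewrite Rintegral_cst//= lebesgue_measure_itv/= mulrC lte_fin; case: ltP => // tk'.
by rewrite (_ : t = node k) ?subrr//; apply/eqP; rewrite eq_le tk' kt.
Qed.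

Lemma velocity_increment s t : 0 <= s -> s <= t -> t <= T ->
  increment dot x (fun r => drift r - thrust r) s t.
Proof.
move=> s0 st tT.
have sm_u : separably_measurable (fun r => drift r - thrust r).
  by apply: sm_sub; [exact: drift_sm|exact: thrust_sm].
have uM r : `|drift r - thrust r| <= push + push.
  by rewrite (le_trans (ler_normB _ _))// lerD ?drift_le ?thrust_le.
have inc0 : increment dot x (fun r => drift r - thrust r) 0 0.
  by move=> p; rewrite subrr dot0l set_itv1 Rintegral_set1.
have incn k : (k <= n)%N -> increment dot x (fun r => drift r - thrust r) 0 (node k).
  elim: k => [_|k IH kn]; first by rewrite tnode0.
  apply: (increment_cat norm_dot sm_u uM _ _ (IH (ltnW kn))) => //.
  by apply: increment_step => //; rewrite lexx andbT node_leS.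
have inct r : 0 <= r -> r <= T -> increment dot x (fun r => drift r - thrust r) 0 r.
  move=> r0 rT; have [r1|] := ltP 0 r; last first.
    by move=> r0'; have -> : r = 0 by apply/eqP; rewrite eq_le r0' r0.
  have [k kn /andP[kr rk]] := tnode_locate n0 r1 rT.
  apply: (increment_cat norm_dot sm_u uM _ _ (incn _ (ltnW kn))) => //; first exact: ltW.
  by apply: increment_step => //; rewrite ltW.
apply: (increment_sub norm_dot sm_u uM s0 st); apply: inct => //.
  exact: le_trans tT.
exact: le_trans st.
Qed.

Lemma scheme_lip s t : 0 <= s -> s <= t -> t <= T -> `|x t - x s| <= (push + push) * (t - s).
Proof.
move=> s0 st tT; apply: (increment_lip norm_dot _ _ st (velocity_increment s0 st tT)).
  by apply: sm_sub; [exact: drift_sm|exact: thrust_sm].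
by move=> r; rewrite (le_trans (ler_normB _ _))// lerD ?drift_le ?thrust_le.
Qed.


Let w : R := Num.sqrt (2 * A + 2 * push) * Num.sqrt theta.

Let w_ge0 : 0 <= w. Proof. by rewrite mulr_ge0// sqrtr_ge0. Qed.

Let w_sqr : w ^+ 2 = (2 * A + 2 * push) * theta.
Proof.
rewrite exprMn !sqr_sqrtr//; have := push_gt0; have := A_ge0; lra.
Qed.

Let m_le : m <= T.
Proof. by rewrite ler_pdivrMr ?ltr0n// ler_peMr ?ler1n// ltW. Qed.

Let err_bound : (push + push + LC + 1) * m + (T + 1) * (2 * w + theta) <= err m theta.
Proof.
rewrite /err /Kerr /w; set ps := Num.sqrt (_ + _); set r := Num.sqrt theta.
have r0 : 0 <= r by exact: sqrtr_ge0.
have ps0 : 0 <= ps by exact: sqrtr_ge0.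
have c0 : 0 <= push + push + LC + 1 by have := push_gt0; have := LC_ge0; lra.
have T1 : 0 <= T + 1 by have := T_gt0; lra.
have h1 : 0 <= (push + push + LC + 1) * (theta + r).
  by apply: mulr_ge0 => //; exact: addr_ge0.
have ps1 : 0 <= 2 * ps + 1 by lra.
have h2 : 0 <= (T + 1) * (2 * ps + 1) * m.
  by apply: mulr_ge0; [exact: mulr_ge0|exact: ltW].
have h3 : 0 <= (T + 1) * (2 * ps * theta + r).
  by apply: mulr_ge0 => //; apply: addr_ge0 => //; rewrite !mulr_ge0.
rewrite -subr_ge0 (_ : _ - _ = (push + push + LC + 1) * (theta + r) +
  (T + 1) * (2 * ps + 1) * m + (T + 1) * (2 * ps * theta + r)); last by ring.
by apply: addr_ge0 => //; exact: addr_ge0.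
Qed.

Let node_close k t : (k < n)%N -> node k < t <= node k.+1 ->
  `|node k.+1 - t| <= m /\ `|x t - xs k.+1| <= (push + push) * m.
Proof.
move=> kn /andP[kt tk].
have d : node k.+1 - t <= m by rewrite -(node_diff k) lerD2l lerN2 ltW.
have t0 : 0 <= t by rewrite (le_trans (node_ge0 k))// ltW.
split; first by rewrite ger0_norm// subr_ge0.
rewrite distrC -(x_node kn) (le_trans (scheme_lip t0 tk (node_le kn)))//.
by rewrite ler_wpM2l//; have := push_gt0; lra.
Qed.

Let pieces_le : [/\ (push + push) * m + w * m + theta * m <= err m theta,
   (push + push) * m + theta * m + (LC * m + m) <= err m theta,
   m <= err m theta & 2 * w + theta <= err m theta].
Proof.
have b := err_bound; have p0 : 0 <= push * m by rewrite mulr_ge0 ?(ltW m0) ?(ltW push_gt0).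
have l0 : 0 <= LC * m by rewrite mulr_ge0 ?(ltW m0).
have wm : w * m <= T * w by rewrite mulrC ler_wpM2r.
have tm : theta * m <= T * theta by rewrite mulrC ler_wpM2r.
have tw : 0 <= T * w by rewrite mulr_ge0 ?(ltW T_gt0).
have tt : 0 <= T * theta by rewrite mulr_ge0 ?(ltW T_gt0).
by split; move: b p0 l0 wm tm tw tt w_ge0 theta0 m0; lra.
Qed.

Lemma drift_field : {ae mu, forall t, 0 < t -> t <= T ->
  exists2 z, `|z - x t| <= err m theta & F t z (drift t)}.
Proof.
have : {ae mu, forall t, forall k, `[0, T]%classic t -> g k t = f t (xs k)}.
  by apply: ae_foralln => k; have [] := gP k.
apply: ae_impl => t gt t0 tT.
have [k kn tk] := tnode_locate n0 t0 tT; have /andP[/ltW kt tk1] := tk.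
have It : `[0, T]%classic t by rewrite /= in_itv/= ltW.
exists (xs k).
  rewrite distrC -(x_node (ltnW kn)) (le_trans (scheme_lip _ kt tT))//.
  apply: (@le_trans _ _ ((push + push) * m)).
    rewrite ler_wpM2l//; first by have := push_gt0; lra.
    by rewrite -(node_diff k) lerD2r.
  have [le1 _ _ _] := pieces_le; apply: le_trans le1.
  have wm : 0 <= w * m by rewrite mulr_ge0// ltW.
  have tm : 0 <= theta * m by rewrite mulr_ge0// ltW.
  by lra.
have -> : drift t = g k t by exact: piecewiseE.
by rewrite gt//; have [] := f_proj (xs k) It.
Qed.

Lemma scheme_near_C t : `[0, T]%classic t -> exists2 z, C t z & `|x t - z| <= err m theta.
Proof.
move=> It; have := It; rewrite /= in_itv/= => /andP[t0 tT].
have [_ le2 _ _] := pieces_le.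
have [t1|t1] := ltP 0 t; last first.
  have -> : t = 0 by apply/eqP; rewrite eq_le t1 t0.
  exists x0 => //; rewrite x_0 subrr normr0 mulr_ge0 ?Kerr_ge0//.
  by rewrite !addr_ge0 ?sqrtr_ge0// ltW.
have [k kn tk] := tnode_locate n0 t1 tT.
have [x' Cx' xx'] := node_near kn.
have [dt dx] := node_close kn tk.
have [z Cz x'z] := C_near (tnode_itv T_gt0 n0 kn) It Cx' m0.
exists z => //.
have : LC * `|node k.+1 - t| <= LC * m by rewrite ler_wpM2l.
have := ler_normD (x t - xs k.+1) (xs k.+1 - x' + (x' - z)).
have := ler_normD (xs k.+1 - x') (x' - z).
rewrite !subrKA; move: xx' dx x'z le2 eta_le; lra.
Qed.

(** The thrust [m^-1 *: (y k - xs k.+1)] belongs to an almost minimal point of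
    [C (node k.+1)], so that [approx_projection_normal] applies; the tolerance there
    is [(w * m) ^+ 2], which is small against [m ^+ 2]. *)
Lemma thrust_normal t : 0 < t -> t <= T -> exists tau xb xi,
  [/\ `[0, T]%classic tau, `|tau - t| <= err m theta, `|xb - x t| <= err m theta,
      clarke_normal dot (C tau) xb xi & `|thrust t - xi| <= err m theta].
Proof.
move=> t0 tT; have [k kn tk] := tnode_locate n0 t0 tT.
have [le1 _ le3 le4] := pieces_le.
have [dt dx] := node_close kn tk.
have [[x' Cx' xx'] ymin] := approx_proj_outerP (xsP kn).
have Y := step_push kn.
set y0 := y k in Y ymin.
have tm : 0 <= theta * m by rewrite mulr_ge0// ltW.
have x'min z : C (node k.+1) z -> `|y0 - x'| ^+ 2 <= `|y0 - z| ^+ 2 + (w * m) ^+ 2.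
  move=> /ymin h1.
  have tri : `|y0 - x'| <= `|y0 - xs k.+1| + theta * m.
    rewrite -(subrKA (xs k.+1)) (le_trans (ler_normD _ _))// lerD2l.
    exact: le_trans eta_le.
  have sq : `|y0 - x'| ^+ 2 <= (`|y0 - xs k.+1| + theta * m) ^+ 2.
    by rewrite lerXn2r ?nnegrE// addr_ge0.
  have pm : `|y0 - xs k.+1| * (theta * m) <= m * push * (theta * m) by rewrite ler_wpM2r.
  have ta : theta * theta * m ^+ 2 <= A * theta * m ^+ 2.
    by rewrite ler_wpM2r ?sqr_ge0// ler_wpM2r.
  rewrite exprMn w_sqr; move: h1 sq pm ta eps_le; lra.
have [xb [Cxb xbx' xbN]] := approx_projection_normal norm_dot
  (C_ball_compact (tnode_itv T_gt0 n0 kn)) Cx' (sqr_ge0 (w * m)) x'min.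
have {}xbx' : `|xb - x'| <= w * m.
  by rewrite -(@ler_pXn2r _ 2) ?nnegrE// mulr_ge0// ltW.
exists (node k.+1), xb, (m^-1 *: ((y0 - xb) + (x' - xb))); split.
- exact: tnode_itv.
- exact: le_trans le3.
- have := ler_normD (xb - x') (x' - xs k.+1 + (xs k.+1 - x t)).
  have := ler_normD (x' - xs k.+1) (xs k.+1 - x t).
  rewrite !subrKA (distrC x' (xs k.+1)) (distrC (xs k.+1) (x t)); move: xbx' xx' dx le1 eta_le; lra.
- by apply: clarke_normalZ => //; rewrite invr_ge0 ltW.
apply: le_trans le4; have -> : thrust t = m^-1 *: (y0 - xs k.+1) by exact: piecewiseE.
rewrite -scalerBr normrZ gtr0_norm ?invr_gt0// ler_pdivrMl//.
have -> : y0 - xs k.+1 - (y0 - xb + (x' - xb)) = (xb - x') + ((xb - x') + (x' - xs k.+1)).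
  by rewrite subrKA opprD addrA !opprB [y0 - _ + _]addrC subrKA addrC.
have := ler_normD (xb - x') ((xb - x') + (x' - xs k.+1)).
have := ler_normD (xb - x') (x' - xs k.+1).
rewrite (distrC x'); move: xbx' xx' eta_le; lra.
Qed.

End FixedStep.


Lemma scheme_velocity n eps eta theta x : (0 < n)%N -> 0 <= eta ->
  0 <= theta -> theta <= A -> eta <= theta * (T / n%:R) ->
  eps <= (theta * (T / n%:R)) ^+ 2 ->
  inexact_catching_up T C f x0 n eps eta x ->
  exists a b : R -> H, let e := err (T / n%:R) theta in
  [/\ separably_measurable a /\ (forall t, `|a t| <= push),
      separably_measurable b /\ (forall t, `|b t| <= push),
      forall s t, 0 <= s -> s <= t -> t <= T -> increment dot x (fun r => a r - b r) s t,
      {ae mu, forall t, 0 < t -> t <= T -> exists2 z, `|z - x t| <= e & F t z (a t)} &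
      (forall t, 0 < t -> t <= T -> exists tau xb xi,
        [/\ `[0, T]%classic tau, `|tau - t| <= e, `|xb - x t| <= e,
            clarke_normal dot (C tau) xb xi & `|b t - xi| <= e]) /\
      (forall t, `[0, T]%classic t -> exists2 z, C t z & `|x t - z| <= e)].
Proof.
move=> n0 eta0 theta0 thetaA eta_le eps_le [xs [xs0 xsP x_0 xE]].
exists (drift n xs), (thrust n xs); split.
- by split; [exact: drift_sm|exact: (drift_le n0 eta0 theta0 thetaA eta_le eps_le xs0 xsP)].
- by split; [exact: thrust_sm|exact: (thrust_le n0 eta0 theta0 thetaA eta_le eps_le xs0 xsP)].
- exact: (velocity_increment n0 eta0 theta0 thetaA eta_le eps_le xs0 xsP x_0 xE).
- exact: (drift_field n0 eta0 theta0 thetaA eta_le eps_le xs0 xsP x_0 xE).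
split; first exact: (thrust_normal n0 eta0 theta0 thetaA eta_le eps_le xs0 xsP x_0 xE).
exact: (scheme_near_C n0 eta0 theta0 thetaA eta_le eps_le xs0 xsP x_0 xE).
Qed.

End Scheme.

(** * Compactness *)

Section Compactness.
Context {R : realType} {H : completeNormedModType R}.

(** An ultrafilter converges to each of its cluster points.  Working with a fixed
    ultrafilter [U] makes the pointwise limits at all times compatible, without any
    diagonal extraction. *)
Lemma ultra_limit (U : set_system nat) (S : set H) (X : nat -> H) (e : nat -> R) (r : R) :
  UltraFilter U -> \oo `<=` U -> ball_compact S -> e @ \oo --> (0 : R) ->
  (forall m, `|X m| <= r) -> (forall m, exists2 z, S z & `|X m - z| <= e m) ->
  exists2 l, S l & forall d : R, 0 < d -> U [set m | `|X m - l| <= d].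
Proof.
move=> UU oU Sc e0 Xr XS.
pose z m := sval (cid2 (XS m)).
have Sz m : S (z m) by rewrite /z; case: cid2.
have Xz m : `|X m - z m| <= e m by rewrite /z; case: cid2.
have small (d : R) : 0 < d -> U [set m | e m <= d].
  move=> d0; apply: oU; have /cvgrPdist_le/(_ _ d0) := e0; apply: filterS => m.
  by rewrite sub0r normrN; apply: le_trans; exact: ler_norm.
have r0 : 0 <= r by rewrite (le_trans _ (Xr 0%N)).
have r1 : 0 < r + 1 by rewrite ltr_wpDl.
have zS : U [set m | (S `&` cball (r + 1)) (z m)].
  apply: filterS (small _ ltr01) => m /= em.
  split=> //; rewrite /cball/= -[z m](subKr (X m)) (le_trans (ler_normB _ _))// lerD//.
  exact: le_trans em.
have [l [[Sl _] lcl]] : (S `&` cball (r + 1)) `&` cluster (z @ U) !=set0.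
  exact: (Sc _ r1 (z @ U) _ zS).
exists l => // d d0; have d20 : 0 < d / 2 by rewrite divr_gt0.
have zU : U [set m | `|z m - l| < d / 2].
  have [//|nU] := in_ultra_setVsetC [set m | `|z m - l| < d / 2] UU.
  have := lcl [set y | ~ (`|y - l| < d / 2)] (ball l (d / 2)) nU (nbhsx_ballx _ _ d20).
  by move=> [y [/= ny]]; rewrite -ball_normE/= distrC.
apply: filterS2 zU (small _ d20) => m /= h1 h2.
rewrite -(subrKA (z m)) (le_trans (ler_normD _ _))// [leRHS]splitr lerD//.
  exact: le_trans (Xz m) h2.
exact: ltW.
Qed.

(** The ultrafilter limits converge simultaneously on a finite grid; between grid
    points the common Lipschitz constant takes over. *)
Lemma equilipschitz_limit (T K r : R) (C : R -> set H) (X : nat -> R -> H) (e : nat -> R) :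
  0 < T -> 0 < K -> (forall t, `[0, T]%classic t -> ball_compact (C t)) ->
  e @ \oo --> (0 : R) ->
  (forall m t, `[0, T]%classic t -> `|X m t| <= r) ->
  (forall m s t, 0 <= s -> s <= t -> t <= T -> `|X m t - X m s| <= K * (t - s)) ->
  (forall m t, `[0, T]%classic t -> exists2 z, C t z & `|X m t - z| <= e m) ->
  exists x : R -> H, (forall t, `[0, T]%classic t -> C t (x t)) /\
    forall (d : R) (N : nat), 0 < d -> exists2 m, (N <= m)%N &
      forall t, `[0, T]%classic t -> `|X m t - x t| <= d.
Proof.
move=> T0 K0 Cc e0 Xr Xlip XC.
have [U [UU oU]] := @ultraFilterLemma nat \oo _.
have lim t : exists l, `[0, T]%classic t ->
    C t l /\ forall d : R, 0 < d -> U [set m | `|X m t - l| <= d].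
  have [It|nIt] := pselect (`[0, T]%classic t); last by exists 0.
  have [l Cl lU] := ultra_limit UU oU (Cc _ It) e0 (Xr ^~ t ^~ It) (XC ^~ t ^~ It).
  by exists l.
pose x t := sval (cid (lim t)).
have xP t : `[0, T]%classic t ->
    C t (x t) /\ forall d : R, 0 < d -> U [set m | `|X m t - x t| <= d].
  by rewrite /x; case: cid.
exists x; split=> [t /xP[]//|d N d0].
have xlip s t : 0 <= s -> s <= t -> t <= T -> `|x t - x s| <= K * (t - s).
  move=> s0 st tT; apply/ler_addgt0Pr => q q0; have q20 : 0 < q / 2 by rewrite divr_gt0.
  have Is : `[0, T]%classic s by rewrite /= in_itv/= s0 (le_trans st).
  have It : `[0, T]%classic t by rewrite /= in_itv/= tT (le_trans s0).
  have [m [/= h1 h2]] := filter_ex (filterI ((xP _ Is).2 _ q20) ((xP _ It).2 _ q20)).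
  rewrite -(subrKA (X m t)) -(subrKA (X m s) (X m t)).
  have := ler_normD (x t - X m t) ((X m t - X m s) + (X m s - x s)).
  have := ler_normD (X m t - X m s) (X m s - x s).
  have := Xlip m s t s0 st tT; rewrite (distrC (x t)); lra.
have d30 : 0 < d / 3 by rewrite divr_gt0.
(* a grid fine enough for the Lipschitz constant [K] *)
pose n := (Num.truncn (K * T / (d / 3))).+1.
have n0 : (0 < n)%N by [].
have Kn : K * (T / n%:R) <= d / 3.
  rewrite mulrA ler_pdivrMr ?ltr0n// [leRHS]mulrC -ler_pdivrMr//.
  by apply: ltW; exact: truncnS_gt.
have grid : U [set m | forall k, (k <= n)%N -> `|X m (tnode T n k) - x (tnode T n k)| <= d / 3].
  have gridj j : U [set m | forall k, (k < j)%N -> (k <= n)%N ->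
      `|X m (tnode T n k) - x (tnode T n k)| <= d / 3].
    elim: j => [|j IH]; first by apply: filterS filterT => m _ k.
    have [jn|jn] := leqP j n; last first.
      apply: filterS IH => m /= IH k; rewrite ltnS leq_eqVlt => /predU1P[->|/IH//].
      by rewrite leqNgt jn.
    apply: filterS2 IH ((xP _ (tnode_itv T0 n0 jn)).2 _ d30) => m /= IH h k.
    by rewrite ltnS leq_eqVlt => /predU1P[->//|/IH].
  by apply: filterS (gridj n.+1) => m /= h k kn; apply: h.
have UN : U [set m | (N <= m)%N] by apply: oU; exists N.
have [m [/= mN mgrid]] := filter_ex (filterI UN grid).
exists m => // t It; have := It; rewrite /= in_itv/= => /andP[t0 tT].
have [k kn /andP[kt tk]] : exists2 k, (k <= n)%N & tnode T n k <= t <= tnode T n k + T / n%:R.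
  have [t1|t1] := ltP 0 t; last first.
    have -> : t = 0 by apply/eqP; rewrite eq_le t1 t0.
    by exists 0%N => //; rewrite tnode0 lexx add0r ltW// step_gt0.
  have [k kn /andP[kt tk]] := tnode_locate n0 t1 tT.
  by exists k; [exact: ltnW|rewrite -tnodeS tk ltW].
have k0 : 0 <= tnode T n k by have := tnode_itv T0 n0 kn; rewrite /= in_itv/= => /andP[].
have dk : K * (t - tnode T n k) <= d / 3.
  by apply: le_trans Kn; rewrite ler_pM2l// lerBlDl.
have := Xlip m _ _ k0 kt tT; have := xlip _ _ k0 kt tT; have := mgrid _ kn.
set s := tnode T n k => h1 h2 h3.
rewrite -(subrKA (X m s)) -(subrKA (x s) (X m s)).
have := ler_normD (X m t - X m s) ((X m s - x s) + (x s - x t)).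
have := ler_normD (X m s - x s) (x s - x t).
rewrite (distrC (x s)); move: h1 h2 h3 dk; rewrite -/s; lra.
Qed.

Lemma extraction (P : nat -> nat -> Prop) : (forall k N, exists2 m, (N <= m)%N & P k m) ->
  exists phi : nat -> nat, {homo phi : i j / (i < j)%N} /\ forall k, P k (phi k).
Proof.
move=> PN; pose s k N := sval (cid2 (PN k N)).
have sN k N : (N <= s k N)%N by rewrite /s; case: cid2.
have sP k N : P k (s k N) by rewrite /s; case: cid2.
pose phi := fix phi k := if k is j.+1 then s j.+1 (phi j).+1 else s 0%N 0%N.
exists phi; split; last by case=> [|k]; exact: sP.
by apply: homo_ltn => [j i k|k /=]; [exact: ltn_trans|exact: sN].
Qed.

Lemma cvg_of_dist {V : normedModType R} (u : nat -> V) (l : V) (e : nat -> R) :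
  e @ \oo --> (0 : R) -> (forall m, `|u m - l| <= e m) -> u @ \oo --> l.
Proof.
move=> e0 ul; apply/cvgrPdist_le => d d0.
have /cvgrPdist_le/(_ _ d0) := e0; apply: filterS => m.
by rewrite sub0r normrN distrC => h; rewrite (le_trans (ul m))// (le_trans (ler_norm _)).
Qed.

Lemma cvg_of_close {V : normedModType R} (u w : nat -> V) (l : V) (e : nat -> R) :
  e @ \oo --> (0 : R) -> (forall m, `|u m - w m| <= e m) -> w @ \oo --> l ->
  u @ \oo --> l.
Proof.
move=> e0 uw wl.
have d0 : (fun m => u m - w m) @ \oo --> (0 : V).
  by apply: (cvg_of_dist e0) => m; rewrite subr0.
rewrite (_ : u = fun m => (u m - w m) + w m); last by apply/funext => m; rewrite subrK.
by rewrite -[l]add0r; apply: cvgD.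
Qed.

Lemma cvg_step (T : R) : T / n%:R @[n --> \oo] --> (0 : R).
Proof.
rewrite -(mulr0 T); apply: cvgMr.
by rewrite -cvg_shiftS; exact: cvg_harmonic.
Qed.

Lemma homo_ltn_ge (phi : nat -> nat) : {homo phi : i j / (i < j)%N} ->
  forall k, (k <= phi k)%N.
Proof. by move=> hphi; elim=> // k IH; exact: leq_ltn_trans IH (hphi _ _ (ltnSn k)). Qed.

Lemma cvg_subseq {V : normedModType R} (u : nat -> V) (l : V) (phi : nat -> nat) :
  {homo phi : i j / (i < j)%N} -> u @ \oo --> l -> (u \o phi) @ \oo --> l.
Proof.
move=> hphi ul; apply: (cvg_comp _ _ _ ul) => A [N _ NA]; exists N => // k /= Nk.
by apply: NA => /=; exact: leq_trans Nk (homo_ltn_ge hphi k).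
Qed.

Lemma cvg_norm_bound (u : nat -> R) (l : R) : u @ \oo --> l ->
  exists2 B : R, 0 < B & forall n, `|u n| <= B.
Proof.
move=> ul; have /cvg_seq_bounded[B [_ Bu]] : cvgn u by apply/cvg_ex; exists l.
exists (`|B| + 1) => [|n]; first by rewrite ltr_wpDl.
by apply: Bu => //; rewrite (le_lt_trans (ler_norm _))// ltrDl.
Qed.

Lemma lipschitz_absolutely_continuous {V : normedModType R} (a b K : R) (x : R -> V) :
  (forall s t, a <= s -> s <= t -> t <= b -> `|x t - x s| <= K * (t - s)) ->
  absolutely_continuous_on a b x.
Proof.
move=> xlip e e0; have K1 : 0 < `|K| + 1 by rewrite ltr_wpDl.
exists (e / (`|K| + 1)); first exact: divr_gt0.
move=> m u v uv _; rewrite ltr_pdivlMr// mulrC => h.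
apply: le_lt_trans h; rewrite mulr_sumr; apply: ler_sum => i _.
have [au uvi vb] := uv i; apply: le_trans (xlip _ _ au uvi vb) _.
by rewrite ler_wpM2r ?subr_ge0// (le_trans (ler_norm _))// lerDl.
Qed.

Lemma dist_uniform_cvg {V : normedModType R} (I : set R) (X : nat -> R -> V)
    (x : R -> V) (e : nat -> R) : e @ \oo --> (0 : R) ->
  (forall k t, I t -> `|X k t - x t| <= e k) ->
  {uniform I, X @ \oo --> x}.
Proof.
move=> e0 Xx P /uniform_nbhs[E [entE EP]].
move: entE; rewrite -entourage_from_ballE => -[d /= d0 dE].
have /cvgrPdist_lt/(_ _ d0) := e0; apply: filterS => k ek; apply: EP => t It.
apply: dE; rewrite /= -ball_normE/= distrC; apply: le_lt_trans (Xx k t It) _.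
by move: ek; rewrite sub0r normrN; apply: le_lt_trans; exact: ler_norm.
Qed.

End Compactness.

(** * Convergence of the algorithm *)

Unset Implicit Arguments.
Set Strict Implicit.
Set Printing Implicit Defensive.

Theorem theorem5p1 (R : realType) (H : completeNormedModType R)
  (dot : {dot H for idfun}) (norm_dot : forall x : H, dot x x = `|x| ^+ 2)
  (T : R) (T_gt0 : 0 < T)
  (C : R -> set H)
  (C_neq0 : forall t : R, `[0, T]%classic t -> C t !=set0)
  (C_closed : forall t : R, `[0, T]%classic t -> closed (C t))
  (LC : R) (LC_ge0 : 0 <= LC)
  (C_lip : forall t s : R, `[0, T]%classic t -> `[0, T]%classic s ->
    (Haus (C t) (C s) <= (LC * `|t - s|)%:E)%E)
  (x0 : H) (x0C : C 0 x0)
  (F : R -> H -> set H)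
  (F_neq0 : forall (t : R) (x : H), `[0, T]%classic t -> F t x !=set0)
  (F_closed : forall (t : R) (x : H), `[0, T]%classic t -> closed (F t x))
  (F_convex : forall (t : R) (x : H), `[0, T]%classic t -> convex_set (F t x))
  (F_usc : forall t : R, `[0, T]%classic t -> weak_usc (F t))
  (h : H -> R) (h_ge0 : forall x, 0 <= h x)
  (Lh : R) (Lh_gt0 : 0 < Lh) (h_lip : Lh.-lipschitz h)
  (F_bound : forall x : H, {ae @lebesgue_measure R, forall t : R,
    `[0, T]%classic t -> (dist (F t x) 0%R <= (h x)%:E)%E})
  (gamma : R) (gamma_gt0 : 0 < gamma)
  (f : R -> H -> H)
  (f_proj : forall (t : R) (x : H), `[0, T]%classic t -> approx_proj gamma (F t x) 0 (f t x))
  (f_meas : forall x, strongly_measurable `[0, T] (f ^~ x))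
  (C_subsmooth : equi_uniformly_subsmooth dot `[0, T] C)
  (C_ball_compact : forall t : R, `[0, T]%classic t -> ball_compact (C t))
  (eps eta : nat -> R)
  (eps_gt0 : forall n, (0 < n)%N -> 0 < eps n)
  (eta_gt0 : forall n, (0 < n)%N -> 0 < eta n)
  (eps_lim : eps n / (T / n%:R) ^+ 2 @[n --> \oo] --> (0 : R))
  (eta_lim : eta n / (T / n%:R) @[n --> \oo] --> (0 : R))
  (xn : nat -> R -> H)
  (xn_cont : forall n, (0 < n)%N -> {within `[0, T], continuous (xn n)})
  (xn_alg : forall n, (0 < n)%N ->
    inexact_catching_up T C f x0 n (eps n) (eta n) (xn n)) :
  exists (phi : nat -> nat) (x : R -> H),
    [/\ {homo phi : i j / (i < j)%N},
        {uniform `[0, T], (fun k => xn (phi k)) @ \oo --> x},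
        [lipschitz x t | t in `[0, T]] &
        sweeping_solution dot T C F x0 x].
Proof.
pose step n : R := T / n%:R.
have step_cvg : step @ \oo --> (0 : R) by exact: cvg_step.
(* the errors [eta n] and [eps n], measured in units of the step *)
pose theta n : R := eta n / step n + Num.sqrt (eps n / step n ^+ 2).
have theta_cvg : theta @ \oo --> (0 : R).
  rewrite -[0]addr0; apply: cvgD => //; rewrite -sqrtr0.
  by apply: continuous_cvg; [exact: sqrt_continuous|exact: eps_lim].
have [A A0 thetaA] := cvg_norm_bound theta_cvg.
have step_pos n : (0 < n)%N -> 0 < step n by move=> n0; exact: step_gt0.
have theta_ge0 n : (0 < n)%N -> 0 <= theta n.
  by move=> n0; rewrite addr_ge0 ?sqrtr_ge0// divr_ge0// ltW ?eta_gt0 ?step_pos.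
have eta_le n : (0 < n)%N -> eta n <= theta n * step n.
  by move=> n0; rewrite -ler_pdivrMr ?step_pos// lerDl sqrtr_ge0.
have eps_le n : (0 < n)%N -> eps n <= (theta n * step n) ^+ 2.
  move=> n0; have s0 := step_pos _ n0; have e0 := eps_gt0 _ n0.
  have q0 : 0 <= eps n / step n ^+ 2 by rewrite divr_ge0 ?sqr_ge0// ltW.
  rewrite exprMn -ler_pdivrMr ?exprn_gt0// -{1}(sqr_sqrtr q0).
  rewrite lerXn2r ?nnegrE ?sqrtr_ge0 ?theta_ge0// lerDr divr_ge0// ltW//; exact: eta_gt0.
pose V := push T LC x0 h Lh gamma A.
have V0 : 0 < V by apply: push_gt0 => //; exact: ltW.
pose E n := err T LC x0 h Lh gamma A (step n) (theta n).
have E_cvg : E @ \oo --> (0 : R).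
  have : E @ \oo --> Kerr T LC x0 h Lh gamma A * (0 + 0 + Num.sqrt 0).
    apply: cvgMr; apply: cvgD; first exact: cvgD.
    by apply: continuous_cvg; [exact: sqrt_continuous|exact: theta_cvg].
  by rewrite sqrtr0 !addr0 mulr0.
have vel n : exists ab : (R -> H) * (R -> H), (0 < n)%N ->
  [/\ separably_measurable ab.1 /\ (forall t, `|ab.1 t| <= V),
      separably_measurable ab.2 /\ (forall t, `|ab.2 t| <= V),
      forall s t, 0 <= s -> s <= t -> t <= T ->
        increment dot (xn n) (fun r => ab.1 r - ab.2 r) s t,
      {ae @lebesgue_measure R, forall t, 0 < t -> t <= T ->
        exists2 z, `|z - xn n t| <= E n & F t z (ab.1 t)} &
      (forall t, 0 < t -> t <= T -> exists tau xb xi,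
        [/\ `[0, T]%classic tau, `|tau - t| <= E n, `|xb - xn n t| <= E n,
            clarke_normal dot (C tau) xb xi & `|ab.2 t - xi| <= E n]) /\
      (forall t, `[0, T]%classic t -> exists2 z, C t z & `|xn n t - z| <= E n)].
  have [n0|] := ltnP 0 n; last by exists (cst 0, cst 0).
  have thA : theta n <= A by rewrite (le_trans (ler_norm _)).
  have [a [b ab]] := scheme_velocity norm_dot T_gt0 LC_ge0 C_lip C_ball_compact x0C
    h_ge0 Lh_gt0 h_lip F_bound gamma_gt0 f_proj f_meas (ltW A0) n0
    (ltW (eta_gt0 _ n0)) (theta_ge0 _ n0) thA (eta_le _ n0) (eps_le _ n0) (xn_alg _ n0).
  by exists (a, b).
pose a n := (sval (cid (vel n))).1; pose b n := (sval (cid (vel n))).2.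
have velP n := svalP (cid (vel n)).
have xn_lip n s t : (0 < n)%N -> 0 <= s -> s <= t -> t <= T ->
    `|xn n t - xn n s| <= (V + V) * (t - s).
  move=> n0 s0 st tT; have [[ma aV] [mb bV] inc _ _] := velP n n0.
  apply: (increment_lip norm_dot (sm_sub ma mb) _ st (inc _ _ s0 st tT)).
  by move=> r; rewrite (le_trans (ler_normB _ _))// lerD.
have xn0 n : (0 < n)%N -> xn n 0 = x0 by move=> /xn_alg[xs []].
have VV0 : 0 < V + V by rewrite addr_gt0.
have [x [xC xX]] : exists x : R -> H, (forall t, `[0, T]%classic t -> C t (x t)) /\
    forall (d : R) (N : nat), 0 < d -> exists2 m, (N <= m)%N &
      forall t, `[0, T]%classic t -> `|xn m.+1 t - x t| <= d.
  apply: (@equilipschitz_limit _ _ T (V + V) (`|x0| + (V + V) * T) C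
    (fun m => xn m.+1) (fun m => E m.+1)) => //.
  - by rewrite (cvg_shiftS E).
  - move=> m t; rewrite /= in_itv/= => /andP[t0 tT].
    rewrite -(subrK x0 (xn m.+1 t)) addrC (le_trans (ler_normD _ _))// lerD2l.
    rewrite -(xn0 m.+1)// (le_trans (xn_lip _ _ _ _ _ t0 tT))// subr0 ler_pM2l//.
  - by move=> m s t; exact: xn_lip.
  - by move=> m t It; have [_ _ _ _ [_ near]] := velP m.+1 isT; exact: near.
have [psi [psi_incr psi_close]] := extraction
  (fun k => xX (harmonic k) ^~ (harmonic_gt0 k)).
(* the shift avoids the index [0], where the algorithm says nothing *)
pose phi k := (psi k).+1.
have phi_incr : {homo phi : i j / (i < j)%N} by move=> i j ij; rewrite ltnS; exact: psi_incr.
have phi0 k : (0 < phi k)%N by [].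
have x_cvg t : `[0, T]%classic t -> xn (phi k) t @[k --> \oo] --> x t.
  by move=> It; apply: (cvg_of_dist cvg_harmonic) => k; exact: psi_close.
have Ephi : E (phi k) @[k --> \oo] --> (0 : R) by exact: (cvg_subseq phi_incr E_cvg).
have velk k := velP (phi k) (phi0 k).
have smA k : separably_measurable (a (phi k)) by have [[]] := velk k.
have aV k t : `|a (phi k) t| <= V by have [[_ kV] _ _ _ _] := velk k; exact: kV.
have smB k : separably_measurable (b (phi k)) by have [_ []] := velk k.
have bV k t : `|b (phi k) t| <= V by have [_ [_ kV] _ _ _] := velk k; exact: kV.
have [tau [v [z [tauP [mv vV] [mz zV] vz_cvg]]]] := mazur_ae norm_dot T smA smB aV bV.
have mu_ := sm_sub mv mz.
have uV t : `|v t - z t| <= V + V by rewrite (le_trans (ler_normB _ _))// lerD.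
pose u k t := a (phi k) t - b (phi k) t.
have smU k : separably_measurable (u k) by exact: sm_sub.
have uVk k t : `|u k t| <= V + V by rewrite (le_trans (ler_normB _ _))// lerD.
have x_inc s t : 0 <= s -> s <= t -> t <= T -> increment dot x (fun r => v r - z r) s t.
  move=> s0 st tT.
  have Is : `[0, T]%classic s by rewrite /= in_itv/= s0 (le_trans st).
  have It : `[0, T]%classic t by rewrite /= in_itv/= tT (le_trans s0).
  have incU k : increment dot (xn (phi k)) (u k) s t.
    by have [_ _ inc _ _] := velk k; exact: inc.
  apply: (@increment_lim _ _ _ norm_dot (fun j r => mix (fun k => xn (phi k) r) (tau j))
    (fun j r => mix (u ^~ r) (tau j)) _ _ (V + V)).
  - by move=> j; exact: sm_mix.
  - by move=> j r; exact: mix_bounded.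
  - by [].
  - by move=> j; exact: (increment_mix norm_dot _ smU uVk incU).
  - exact: mix_cvg tauP (x_cvg _ Is).
  - exact: mix_cvg tauP (x_cvg _ It).
  apply: ae_impl vz_cvg => r vz; rewrite /= in_itv/= => /andP[sr rt].
  have [|va vb] := vz; first by rewrite /= in_itv/= (le_trans s0 sr) (le_trans rt tT).
  by under eq_fun do rewrite mixB; exact: cvgB.
have x_lip s t : 0 <= s -> s <= t -> t <= T -> `|x t - x s| <= (V + V) * (t - s).
  by move=> s0 st tT; exact: (increment_lip norm_dot mu_ uV st (x_inc _ _ s0 st tT)).
have I0 : `[0, T]%classic 0 by rewrite /= in_itv/= lexx ltW.
exists phi, x; split=> //.
- by apply: (dist_uniform_cvg cvg_harmonic) => k t It; exact: psi_close.
- exists (V + V); split; first exact: num_real.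
  move=> M /ltW VM [s t] /= [].
  rewrite /= !in_itv/= => /andP[s0 sT] /andP[t0 tT].
  apply: (@le_trans _ _ ((V + V) * `|s - t|)); last by rewrite ler_wpM2r.
  have [st|/ltW ts] := leP s t.
    by rewrite distrC (distrC s) (ger0_norm (_ : 0 <= t - s)) ?subr_ge0// x_lip.
  by rewrite (ger0_norm (_ : 0 <= s - t)) ?subr_ge0// x_lip.
split.
- exact: lipschitz_absolutely_continuous x_lip.
- have cl := x_cvg _ I0.
  have cr : (fun k => xn (phi k) 0) @ \oo --> x0.
    by under eq_fun do rewrite xn0//; exact: cvg_cst.
  exact: cvg_unique cl cr.
have drift_ae : {ae @lebesgue_measure R, forall t, forall k, 0 < t -> t <= T ->
    exists2 y, `|y - xn (phi k) t| <= E (phi k) & F t y (a (phi k) t)}.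
  by apply: ae_foralln => k; have [_ _ _ dr _] := velk k.
have not0 : {ae @lebesgue_measure R, forall t : R, t <> 0}.
  exists [set 0]; split; [exact: measurable_set1|exact: lebesgue_measure_set1|].
  by move=> t /= /contrapT.
have x_der := increment_derivable norm_dot mu_ uV x_inc.
apply: ae_impl (ae_and (ae_and drift_ae not0) (ae_and x_der vz_cvg)).
move=> t [[dr t_neq0] [der vz]] It; have [dx dxE] := der It; have [va vb] := vz It.
have := It; rewrite /= in_itv/= => /andP[t_ge0 tT].
have t0 : 0 < t by rewrite lt_neqAle t_ge0 andbT; apply/eqP => /esym.
split=> //; rewrite dxE; exists (z t); last first.
  exists (v t); last by rewrite addrC.
  have [y yx yF] : exists2 y : nat -> H, forall k, `|y k - xn (phi k) t| <= E (phi k) &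
      forall k, F t (y k) (a (phi k) t).
    exists (fun k => sval (cid2 (dr k t0 tT))) => k; by case: cid2.
  have yx_cvg : y @ \oo --> x t.
    exact: (cvg_of_close Ephi yx (x_cvg _ It)).
  apply: (weak_usc_mix norm_dot (F_usc _ It) (F_neq0 _ _ It) (F_closed _ _ It)
    (F_convex _ _ It) yx_cvg _ tauP va).
  exact: nearW.
have [B B0 EB] := cvg_norm_bound Ephi.
have nrm k : exists q : R * (H * H), [/\ `[0, T]%classic q.1, `|q.1 - t| <= E (phi k),
    `|q.2.1 - xn (phi k) t| <= E (phi k), clarke_normal dot (C q.1) q.2.1 q.2.2 &
    `|b (phi k) t - q.2.2| <= E (phi k)].
  have [_ _ _ _ [th _]] := velk k; have [q1 [q2 [q3 qP]]] := th t t0 tT.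
  by exists (q1, (q2, q3)).
pose q k := sval (cid (nrm k)).
have qP k := svalP (cid (nrm k)).
have xb_cvg : (q k).2.1 @[k --> \oo] --> x t.
  by apply: (cvg_of_close Ephi _ (x_cvg _ It)) => k; have [] := qP k.
apply: (@normal_mix _ _ _ norm_dot `[0, T]%classic C LC (V + B) t (fun k => (q k).1) (x t) (z t)
  (fun k => (q k).2.1) (fun k => (q k).2.2) (fun k => b (phi k) t) tau) => //.
- by move=> t1 s1 It1 Is1 y e; exact: (C_near C_lip).
- exact: xC.
- by move=> k; have [] := qP k.
- by apply: (cvg_of_dist Ephi) => k; have [] := qP k.
- by move=> k; have [] := qP k.
- exact: addr_gt0.
- move=> k; have [_ _ _ _ bq] := qP k.
  rewrite -[(q k).2.2](subKr (b (phi k) t)) (le_trans (ler_normB _ _))// lerD//.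
  by rewrite (le_trans bq)// (le_trans (ler_norm _)).
- by apply: (cvg_of_dist Ephi) => k; rewrite subr0; have [] := qP k.
Qed.
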